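(* For every non-zero integer $n$, the winding rail arc class $[W_n]$ has stick number $$s[W_n]=4+2(|n|-1).$$
   Context: Rail arcs. Let $\ell_1,\ell_2\subset\mathbb{R}^3$ be two parallel lines, called rails. A rail arc is an embedding of a simple arc $r$ in $\mathbb{R}^3$ with one endpoint on $\ell_1$, the other on $\ell_2$, and interior disjoint from $\ell_1\cup\ell_2$. Two rail arcs are rail isotopic if there is an ambient isotopy of $\mathbb{R}^3$ taking one to the other while mapping each rail onto itself throughout. A rail arc class is a rail isotopy class. A stick rail arc is a piecewise linear rail arc seen as a finite union of line segments (sticks); the stick number $s[r]$ is the minimum number of sticks of a stick rail arc representing $[r]$. Winding rail arcs. $W_n$ is the rail arc that winds monotonically around and down its rails $|n|$ times, clockwise if $n<0$ and counter-clockwise if $n>0$. Concretely, take the rails to be the vertical lines through $T=(1,0)$ and $H=(-1,0)$ in the horizontal plane. For $n>0$, let the projection of $W_n$ start at the tail $T$, follow the spiral given in polar coordinates about the origin by $\rho(\theta)=1+\theta/\pi$ for $0\le\theta\le(2n+1)\pi$, and then follow the straight radial segment along the negative $x$-axis from the end of the spiral inward to the head $H$; this projection has exactly $n$ crossings. The height coordinate strictly decreases along the arc from tail to head, so the spiral passes over the final segment at every crossing. For $n<0$, the projection of $W_n$ is the reflection of the projection of $W_{|n|}$ in the $x$-axis, again with strictly decreasing height. *)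

(* Defs.v *)
From mathcomp Require Import all_boot all_order all_algebra.
From mathcomp Require Import all_classical all_reals all_analysis.

Set Implicit Arguments.
Unset Strict Implicit.
Unset Printing Implicit Defensive.

Import Order.TTheory GRing.Theory Num.Theory.
Import numFieldNormedType.Exports.

Local Open Scope classical_set_scope.
Local Open Scope ring_scope.

Definition point3 (R : realType) (x y z : R) : 'rV[R]_3 :=
  \row_(i < 3) [:: x; y; z]`_i.

Definition vertical_line (R : realType) (x y : R) : set 'rV[R]_3 :=
  [set point3 x y z | z in setT].

Definition tail_rail (R : realType) : set 'rV[R]_3 := vertical_line 1 0.
Definition head_rail (R : realType) : set 'rV[R]_3 := vertical_line (-1) 0.
Arguments tail_rail R : clear implicits.
Arguments head_rail R : clear implicits.

(* A continuous injection of the compact interval [0, 1] in R^3 is an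
   embedding. Fixing which endpoint lies on which rail costs nothing, since
   arcs are unoriented: only the image of gamma matters below. *)
Definition rail_arc_param (R : realType) (l1 l2 : set 'rV[R]_3)
    (gamma : R -> 'rV[R]_3) : Prop :=
  [/\ {within `[0, 1], continuous gamma},
      {in `[0, 1] &, injective gamma},
      l1 (gamma 0), l2 (gamma 1) &
      forall s : R, 0 < s < 1 -> ~ (l1 `|` l2) (gamma s)].

(* gamma is affine on each of the k pieces of a subdivision of [0, 1]; when
   gamma is injective, these are k nondegenerate sticks. *)
Definition affine_pieces (R : realType) (k : nat) (gamma : R -> 'rV[R]_3) :
    Prop :=
  exists t : nat -> R,
    [/\ t 0%N = 0, t k = 1,
        forall i, (i < k)%N -> t i < t i.+1 &
        forall i, (i < k)%N -> forall s : R, 0 <= s <= 1 ->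
          gamma ((1 - s) * t i + s * t i.+1) =
          (1 - s) *: gamma (t i) + s *: gamma (t i.+1)].

Definition stick_rail_arc (R : realType) (l1 l2 : set 'rV[R]_3) (k : nat)
    (r : set 'rV[R]_3) : Prop :=
  exists gamma, [/\ rail_arc_param l1 l2 gamma, affine_pieces k gamma &
                    r = gamma @` `[0, 1]].

Definition homeomorphism (T U : topologicalType) (f : T -> U) : Prop :=
  continuous f /\
  exists g : U -> T, [/\ continuous g, cancel f g & cancel g f].

Definition ambient_isotopy (R : realType)
    (F : R -> 'rV[R]_3 -> 'rV[R]_3) : Prop :=
  [/\ {within `[0, 1] `*` setT,
         continuous (fun p : R * 'rV[R]_3 => F p.1 p.2)},
      forall v, F 0 v = v &
      forall t : R, 0 <= t <= 1 -> homeomorphism (F t)].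

Definition rail_isotopic (R : realType) (l1 l2 r1 r2 : set 'rV[R]_3) : Prop :=
  exists F : R -> 'rV[R]_3 -> 'rV[R]_3,
    [/\ ambient_isotopy F,
        forall t : R, 0 <= t <= 1 -> F t @` l1 = l1 /\ F t @` l2 = l2 &
        F 1 @` r1 = r2].

Definition stick_presentable (R : realType) (l1 l2 r : set 'rV[R]_3)
    (k : nat) : Prop :=
  exists2 r', stick_rail_arc l1 l2 k r' & rail_isotopic l1 l2 r r'.

(* The least k such that stick_presentable l1 l2 r k. The default value 0,
   returned if there is no such k, is never attained otherwise, because
   affine_pieces 0 is contradictory. *)
Definition stick_number (R : realType) (l1 l2 r : set 'rV[R]_3) : nat :=
  xget 0%N [set k | stick_presentable l1 l2 r k /\
                    forall m, stick_presentable l1 l2 r m -> (k <= m)%N].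

Definition spiral_end (R : realType) (n : int) : R :=
  (2 * `|n|%N + 1)%:R * pi.

(* The radial segment, of length 2|n| + 1, is run at unit speed after the
   spiral. *)
Definition winding_end (R : realType) (n : int) : R :=
  spiral_end R n + (2 * `|n|%N + 1)%:R.

(* Parametrized by theta in [0, winding_end R n]. At theta = spiral_end R n
   both branches give the point (- (2|n| + 2), 0). The factor sgz n reflects
   the spiral in the x-axis when n < 0. *)
Definition winding_x (R : realType) (n : int) (theta : R) : R :=
  if theta <= spiral_end R n then (1 + theta / pi) * cos theta
  else - (1 + (winding_end R n - theta)).

Definition winding_y (R : realType) (n : int) (theta : R) : R :=
  if theta <= spiral_end R n then (sgz n)%:~R * ((1 + theta / pi) * sin theta)
  else 0.

(* The projection of the arc is prescribed, and its height is an arbitrary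
   continuous strictly decreasing function of the parameter. *)
Definition winding_rail_arc (R : realType) (n : int) (r : set 'rV[R]_3) :
    Prop :=
  exists h : R -> R,
    [/\ {within `[0, winding_end R n], continuous h},
        forall a b : R, 0 <= a -> a < b -> b <= winding_end R n -> h b < h a &
        r = [set point3 (winding_x n theta) (winding_y n theta) (h theta)
            | theta in `[0, winding_end R n]]].

(* Main.v *)
Require Import Defs.
From mathcomp Require Import all_boot all_order all_algebra.
From mathcomp Require Import all_classical all_reals all_analysis.
From mathcomp Require Import ring lra.

Set Implicit Arguments.
Unset Strict Implicit.
Unset Printing Implicit Defensive.

Import Order.TTheory GRing.Theory Num.Theory.
Import numFieldNormedType.Exports.

Local Open Scope classical_set_scope.
Local Open Scope ring_scope.

(** The projection of a rail arc to the horizontal plane is a path between the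
    punctures [(1, 0)] and [(-1, 0)], and a rail isotopy projects to a homotopy
    of such paths that avoids the punctures in between.  All arguments take
    place in this plane.

    Lower bound.  The complex cosine is a covering of the plane branched at the
    two punctures only.  Lift a homotopy through it and write [x] for the real
    part: a path starts near a multiple of 2 pi and ends near an odd multiple
    of pi, and both stay put along the homotopy.  Off the interval between the
    punctures [x] follows, up to sign and within a quarter turn, the polar
    angle.  So the winding arc runs from 0 to [(2|n| + 1) pi] for a suitable
    choice of the lift, and so does any arc isotopic to it ([homotopy_sweep]).
    For a polygon, [x] is a multiple of pi only on the line through the
    punctures, outside the interval between them, and consecutive multiples lie
    beyond opposite punctures.  A stick which meets two of them lies in this
    line and hits a puncture.  Hence each stick passes at most one multiple
    beyond the one reached before, and the first and the last stick, which touch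
    the line at a puncture already, none ([stick_count]).  This forces at least
    [2|n| + 2] sticks.

    Upper bound.  Both the winding arc and the polygon constructed below
    descend strictly, so it is enough to move the one point of the arc in each
    horizontal plane, continuously in the height, by homeomorphisms that fix
    the punctures.  A twist about the origin corrects the polar angle
    ([twist_motion]), a radial stretch with respect to a norm corrects the
    distance ([stretch_motion]), and a motion of the heights makes the arc
    affine on each edge ([lift_motion]).  The polygon has [2|n| + 2] edges, each
    seen from the origin under the same angle, which is less than pi
    ([poly_angle]). *)

(** * Continuity of explicit formulas *)

Section ContinuityCombinators.
Context {R : realType} {T : topologicalType}.
Implicit Types (f g : T -> R) (x : T).

Lemma continuous_at_cst (c : R) x : continuous_at x (fun _ : T => c).
Proof. exact: cvg_cst. Qed.

Lemma continuous_at_add f g x : continuous_at x f -> continuous_at x g ->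
  continuous_at x (fun y => f y + g y).
Proof. exact: cvgD. Qed.

Lemma continuous_at_opp f x : continuous_at x f ->
  continuous_at x (fun y => - f y).
Proof. exact: cvgN. Qed.

Lemma continuous_at_mul f g x : continuous_at x f -> continuous_at x g ->
  continuous_at x (fun y => f y * g y).
Proof. exact: cvgM. Qed.

Lemma continuous_at_inv f x : f x != 0 -> continuous_at x f ->
  continuous_at x (fun y => (f y)^-1).
Proof. exact: cvgV. Qed.

Lemma continuous_at_max f g x : continuous_at x f -> continuous_at x g ->
  continuous_at x (fun y => Num.max (f y) (g y)).
Proof. exact: continuous_max. Qed.

Lemma continuous_at_min f g x : continuous_at x f -> continuous_at x g ->
  continuous_at x (fun y => Num.min (f y) (g y)).
Proof. exact: continuous_min. Qed.

Lemma continuous_at_norm f x : continuous_at x f ->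
  continuous_at x (fun y => `|f y|).
Proof. exact: cvg_norm. Qed.

Lemma continuous_at_comp (g : R -> R) f x : continuous_at (f x) g ->
  continuous_at x f -> continuous_at x (fun y => g (f y)).
Proof. by move=> gc fc; apply: (continuous_comp fc gc). Qed.

Lemma continuous_at_exp f (n : nat) x : continuous_at x f ->
  continuous_at x (fun y => f y ^+ n).
Proof.
move=> fc; elim: n => [|n IH]; first exact: continuous_at_cst.
rewrite (_ : (fun y => _) = (fun y => f y * f y ^+ n)); last first.
  by apply/funext => y; rewrite exprS.
exact: continuous_at_mul.
Qed.

Lemma continuous_at_sum (n : nat) (F : 'I_n -> T -> R) x :
  (forall i, continuous_at x (F i)) ->
  continuous_at x (fun y => \sum_(i < n) F i y).
Proof.
move=> Fc; elim: n F Fc => [|n IH] F Fc.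
  rewrite (_ : (fun y => _) = (fun => 0)); first exact: continuous_at_cst.
  by apply/funext => y; rewrite big_ord0.
rewrite (_ : (fun y => _) =
  (fun y => (\sum_(i < n) F (widen_ord (leqnSn n) i) y) + F ord_max y)).
  by apply: continuous_at_add; [apply: IH => i | ].
by apply/funext => y; rewrite big_ord_recr.
Qed.

(** At a zero of the continuous factor [g] the product is continuous whatever
    the bounded factor [q] does. *)
Lemma continuous_at_mul_bounded g q x : continuous_at x g ->
  (forall y, `|q y| <= 1) -> (g x != 0 -> continuous_at x q) ->
  continuous_at x (fun y => g y * q y).
Proof.
move=> gc q1 qc; have [g0|gn0] := eqVneq (g x) 0; last first.
  exact: continuous_at_mul gc (qc gn0).
move=> /=; rewrite g0 mul0r; apply/cvgr0Pnorm_le => e e0.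
have : \forall y \near x, `|g x - g y| <= e.
  by move/cvgrPdist_le : gc; apply.
apply: filterS => y; rewrite g0 sub0r normrN => ge.
by rewrite normrM -[e]mulr1 ler_pM.
Qed.

End ContinuityCombinators.

Section ElementaryFunctions.
Context {R : realType} {T : topologicalType}.
Implicit Types (f : T -> R) (x : T).

Definition clamp (a b x : R) : R := Num.max a (Num.min b x).

Lemma continuous_at_clamp a b f x : continuous_at x f ->
  continuous_at x (fun y => clamp a b (f y)).
Proof.
by move=> fc; apply: continuous_at_max; [|apply: continuous_at_min];
  try exact: continuous_at_cst.
Qed.

Lemma clamp_cont (a b : R) : continuous (clamp a b).
Proof.
by move=> y; apply: continuous_at_max; [|apply: continuous_at_min]; 
  try exact: continuous_at_cst; exact: cvg_id.
Qed.

Lemma continuous_at_cos f x : continuous_at x f -> continuous_at x (fun y => cos (f y)).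
Proof. by apply: (@continuous_at_comp _ _ cos); exact: continuous_cos. Qed.

Lemma continuous_at_sin f x : continuous_at x f -> continuous_at x (fun y => sin (f y)).
Proof. by apply: (@continuous_at_comp _ _ sin); exact: continuous_sin. Qed.

Lemma continuous_at_atan f x : continuous_at x f ->
  continuous_at x (fun y => atan (f y)).
Proof. by apply: (@continuous_at_comp _ _ atan); exact: continuous_atan. Qed.

Lemma continuous_at_sqrt f x : continuous_at x f ->
  continuous_at x (fun y => Num.sqrt (f y)).
Proof. by apply: (@continuous_at_comp _ _ Num.sqrt); exact: sqrt_continuous. Qed.

End ElementaryFunctions.

Section Projections.
Context {S T U : topologicalType}.

Lemma fst_cont : continuous (fun p : T * U => p.1).
Proof. by move=> p; exact: cvg_fst. Qed.

Lemma snd_cont : continuous (fun p : T * U => p.2).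
Proof. by move=> p; exact: cvg_snd. Qed.

Lemma continuous_at_pair (f : S -> T) (g : S -> U) x :
  continuous_at x f -> continuous_at x g ->
  continuous_at x (fun y => (f y, g y)).
Proof. exact: cvg_pair. Qed.

Lemma continuous_at_of (g : T -> U) (f : S -> T) x : continuous g ->
  continuous_at x f -> continuous_at x (fun y => g (f y)).
Proof. by move=> gc fc; apply: (continuous_comp fc); exact: gc. Qed.

End Projections.

Lemma continuous_at_coord {R : realType} (T : topologicalType)
    (V : T -> 'rV[R]_3) i j x :
  continuous_at x V -> continuous_at x (fun y => V y i j).
Proof.
apply: (@continuous_at_of _ _ _ (fun v : 'rV[R]_3 => v i j)).
exact: coord_continuous.
Qed.

Ltac cont_step := lazymatch goal with
  | |- continuous_at ?x (fun y => @fun_of_matrix _ _ _ (@?V y) ?i ?j) =>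
      refine (@continuous_at_coord _ _ V i j x _)
  | |- continuous_at ?x (fun y => @GRing.add _ (@?f y) (@?g y)) =>
      refine (@continuous_at_add _ _ f g x _ _)
  | |- continuous_at ?x (fun y => @GRing.opp _ (@?f y)) =>
      refine (@continuous_at_opp _ _ f x _)
  | |- continuous_at ?x (fun y => @GRing.mul _ (@?f y) (@?g y)) =>
      refine (@continuous_at_mul _ _ f g x _ _)
  | |- continuous_at ?x (fun y => @Order.max _ _ (@?f y) (@?g y)) =>
      refine (@continuous_at_max _ _ f g x _ _)
  | |- continuous_at ?x (fun y => @Order.min _ _ (@?f y) (@?g y)) =>
      refine (@continuous_at_min _ _ f g x _ _)
  | |- continuous_at ?x (fun y => @Num.norm _ _ (@?f y)) =>
      refine (@continuous_at_norm _ _ f x _)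
  | |- continuous_at ?x (fun y => @GRing.exp _ (@?f y) ?n) =>
      refine (@continuous_at_exp _ _ f n x _)
  | |- continuous_at ?x (fun y => clamp ?a ?b (@?f y)) =>
      refine (@continuous_at_clamp _ _ a b f x _)
  | |- continuous_at ?x (fun y => cos (@?f y)) => refine (@continuous_at_cos _ _ f x _)
  | |- continuous_at ?x (fun y => sin (@?f y)) => refine (@continuous_at_sin _ _ f x _)
  | |- continuous_at ?x (fun y => atan (@?f y)) => refine (@continuous_at_atan _ _ f x _)
  | |- continuous_at ?x (fun y => Num.sqrt (@?f y)) =>
      refine (@continuous_at_sqrt _ _ f x _)
  | |- continuous_at ?x (fun y => (@?f y, @?g y)) =>
      refine (@continuous_at_pair _ _ _ f g x _ _)
  | |- continuous_at ?x (fun y => y) => exact: cvg_id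
  | |- continuous_at ?x (fun y => y.1) => exact: fst_cont
  | |- continuous_at ?x (fun y => y.2) => exact: snd_cont
  | H : continuous ?g |- continuous_at ?x ?g => exact: H
  | H : continuous ?g |- continuous_at ?x (fun y => ?g (@?f y)) =>
      refine (@continuous_at_of _ _ _ g f x H _)
  | |- continuous_at ?x _ => exact: continuous_at_cst
  end.

Ltac cont := try (match goal with |- prop_for _ _ => rewrite /prop_for end);
  repeat cont_step.

Section Topology.
Context {R : realType}.

Lemma within_comp (S T U : topologicalType) (A : set T) (f : T -> U)
    (g : S -> T) :
  {within A, continuous f} -> continuous g -> (forall x, A (g x)) ->
  continuous (fun x => f (g x)).
Proof.
move=> /subspace_continuousP fc gc gA x.
have fg := fc (g x) (gA x).
apply: cvg_trans fg => B /= fB.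
rewrite /within /= in fB.
have := gc x _ fB; rewrite /nbhs /=.
by apply: filterS => y; apply.
Qed.

Lemma clamp_itv (a b x : R) : a <= b -> a <= clamp a b x <= b.
Proof.
by move=> ab; rewrite /clamp le_max lexx /= ge_max ab ge_min lexx.
Qed.

Lemma clamp_id (a b x : R) : a <= x <= b -> clamp a b x = x.
Proof.
by case/andP=> ax xb; rewrite /clamp (min_idPr xb) (max_idPr ax).
Qed.

Lemma clamp_lo (a b x : R) : x <= a -> a <= b -> clamp a b x = a.
Proof.
by move=> xa ab; rewrite /clamp (min_idPr (le_trans xa ab)) (max_idPl xa).
Qed.

Lemma clamp_hi (a b x : R) : b <= x -> a <= b -> clamp a b x = b.
Proof. by move=> bx ab; rewrite /clamp (min_idPl bx) (max_idPr ab). Qed.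

Lemma point3_cont (T : topologicalType) (f g h : T -> R) :
  continuous f -> continuous g -> continuous h ->
  continuous (fun x => point3 (f x) (g x) (h x)).
Proof.
move=> fc gc hc x.
move=> A /= [P Px sPA].
have : \forall y \near x, forall j : 'I_3, P 0 j (point3 (f y) (g y) (h y) 0 j).
  apply: filter_forall => j; have := Px 0 j; rewrite !mxE.
  case: j => -[|[|[|//]]] ? /= H.
  - by have := fc x _ H; rewrite /nbhs /=; apply: filterS => y; rewrite mxE.
  - by have := gc x _ H; rewrite /nbhs /=; apply: filterS => y; rewrite mxE.
  - by have := hc x _ H; rewrite /nbhs /=; apply: filterS => y; rewrite mxE.
rewrite /nbhs /=; apply: filterS => y Py; apply: sPA => i j.
by rewrite (ord1 i).
Qed.

End Topology.

Notation X_ v := (v 0 (@Ordinal 3 0 isT)).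
Notation Y_ v := (v 0 (@Ordinal 3 1 isT)).
Notation Z_ v := (v 0 (@Ordinal 3 2 isT)).

Section Points.
Context {R : realType}.
Implicit Type v : 'rV[R]_3.

Lemma point3K v : point3 (X_ v) (Y_ v) (Z_ v) = v.
Proof.
apply/rowP => i; rewrite mxE; case: i => -[|[|[|//]]] ? /=;
  by congr (v 0 _); apply/val_inj.
Qed.

Lemma X_point3 (x y z : R) : X_ (point3 x y z) = x. Proof. by rewrite mxE. Qed.
Lemma Y_point3 (x y z : R) : Y_ (point3 x y z) = y. Proof. by rewrite mxE. Qed.
Lemma Z_point3 (x y z : R) : Z_ (point3 x y z) = z. Proof. by rewrite mxE. Qed.

Lemma vertical_lineE (x y : R) v :
  vertical_line x y v <-> X_ v = x /\ Y_ v = y.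
Proof.
split=> [[z _ <-]|[<- <-]]; first by rewrite X_point3 Y_point3.
by exists (Z_ v) => //; rewrite point3K.
Qed.

End Points.

Definition point3E := (@X_point3, @Y_point3, @Z_point3).

(** * Lifting through the complex cosine *)

Section Angles.
Context {R : realType}.

(** Lebesgue number lemma for a property of pairs of points that holds near the
    diagonal of a compact set. *)
Lemma lebesgue_pairs (T : pseudoMetricType R) (K : set T) (G : T -> T -> Prop) :
  compact K -> (forall x, K x -> \forall p \near (x, x), G p.1 p.2) ->
  exists2 d : R, 0 < d & forall p q, K p -> ball p d q -> G p q.
Proof.
move=> /compact_near_coveringP Kc GK.
pose P (d : R) (p : T) := forall q, ball p d q -> G p q.
have : \forall d \near (0:R)^'+, K `<=` P d.
  apply: Kc => x Kx.
  have [[A B] /= [Ax Bx] AB] := GK x Kx.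
  have /nbhs_ballP [r1 /= r10 r1A] := Ax.
  have /nbhs_ballP [r2 /= r20 r2B] := Bx.
  exists (ball x (Num.min r1 (r2 / 2)), [set d | 0 < d < r2 / 2]) => /=.
    split; first by apply: nbhsx_ballx; rewrite lt_min r10 divr_gt0.
    have : 0 < r2 / 2 by rewrite divr_gt0.
    by move=> ?; near=> d; rewrite /=; apply/andP; split; near: d;
      [exact: nbhs_right_gt | exact: nbhs_right_lt].
  move=> [y d] /= [xy /andP[d0 dr]] q yq; apply: (AB (y, q)); split=> /=.
    by apply: r1A; apply: le_ball xy; rewrite ge_min lexx.
  apply: r2B; rewrite (splitr r2); apply: (@ball_triangle _ _ y).
    by apply: le_ball xy; rewrite ge_min lexx orbT.
  by apply: le_ball yq; exact: ltW.
move=> Hd.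
have [d [d0 KP]] : exists d : R, 0 < d /\ K `<=` P d.
  near (0:R)^'+ => d; exists d; split; near: d => //.
  exact: nbhs_right_gt.
by exists d => // p q Kp; exact: KP.
Unshelve. all: by end_near. Qed.

Definition rect (a b c d : R) : set (R * R) := `[a, b] `*` `[c, d].

Lemma rectP a b c d (p : R * R) :
  rect a b c d p <-> a <= p.1 <= b /\ c <= p.2 <= d.
Proof. by rewrite /rect /= !in_itv /=. Qed.

Lemma rect_compact a b c d : compact (rect a b c d).
Proof. by apply: compact_setX; exact: segment_compact. Qed.

(** The modulus is required to be positive, so this also says that the vector
    is nonzero. *)
Definition angle_of (u1 u2 a : R) : Prop :=
  exists2 rho, 0 < rho & u1 = rho * cos a /\ u2 = rho * sin a.

Lemma angle_exists (u1 u2 : R) : (u1, u2) <> (0, 0) ->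
  exists a, angle_of u1 u2 a.
Proof.
move=> u0; set q := u1 ^+ 2 + u2 ^+ 2.
have q0 : 0 < q.
  rewrite lt_neqAle addr_ge0 ?sqr_ge0 // andbT eq_sym /q paddr_eq0 ?sqr_ge0 //.
  by rewrite !sqrf_eq0; apply/andP => -[/eqP u10 /eqP u20]; rewrite u10 u20 in u0.
have s0 : 0 < Num.sqrt q by rewrite sqrtr_gt0.
have sq : Num.sqrt q ^+ 2 = q by rewrite sqr_sqrtr // ltW.
set c := u1 / Num.sqrt q.
have c2 : c ^+ 2 + (u2 / Num.sqrt q) ^+ 2 = 1.
  by rewrite /c !expr_div_n sq -mulrDl divff // gt_eqF.
have c1 : -1 <= c <= 1.
  have : c ^+ 2 <= 1 by rewrite -c2 lerDl sqr_ge0.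
  by move=> ?; apply/andP; split; nra.
have cK : cos (acos c) = c by rewrite acosK // in_itv.
have sK : sin (acos c) = `|u2 / Num.sqrt q|.
  by rewrite sin_acos // -c2 addrC addKr sqrtr_sqr.
have [u2p|u2n] := leP 0 u2.
  exists (acos c), (Num.sqrt q) => //; rewrite cK sK ger0_norm; last first.
    by rewrite divr_ge0 // ltW.
  by rewrite /c; split; rewrite mulrC divfK // gt_eqF.
exists (- acos c), (Num.sqrt q) => //; rewrite cosN sinN cK sK ltr0_norm; last first.
  by rewrite pmulr_llt0 // invr_gt0.
by rewrite opprK /c; split; rewrite mulrC divfK // gt_eqF.
Qed.

(** Two vectors with positive scalar product differ by a turn of less than a
    right angle, which [atan] computes continuously. *)
Lemma angle_step (u1 u2 w1 w2 a : R) : 0 < u1 * w1 + u2 * w2 ->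
  angle_of u1 u2 a ->
  angle_of w1 w2 (a + atan ((u1 * w2 - u2 * w1) / (u1 * w1 + u2 * w2))).
Proof.
set re := u1 * w1 + _; set im := u1 * w2 - _ => re0 [rho rho0 [u1E u2E]].
set b := atan _.
have cb : 0 < cos b by apply: cos_gt0_pihalf; rewrite atan_gtNpi2 atan_ltpi2.
have sb : sin b = cos b * (im / re).
  by rewrite -[im / re]atanK -/b /tan mulrCA divff ?mulr1 // gt_eqF.
have uu : u1 ^+ 2 + u2 ^+ 2 = rho ^+ 2.
  by rewrite u1E u2E !exprMn -mulrDr cos2Dsin2 mulr1.
exists (re / (rho * cos b)); first by rewrite divr_gt0 // mulr_gt0.
have ca : cos a = u1 / rho by rewrite u1E mulrAC divff ?mul1r // gt_eqF.
have sa : sin a = u2 / rho by rewrite u2E mulrAC divff ?mul1r // gt_eqF.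
rewrite cosD sinD sb ca sa.
have -> : re / (rho * cos b) * (u1 / rho * cos b - u2 / rho * (cos b * (im / re)))
    = (u1 * re - u2 * im) / rho ^+ 2.
  by field; rewrite !gt_eqF.
have -> : re / (rho * cos b) * (u2 / rho * cos b + u1 / rho * (cos b * (im / re)))
    = (u2 * re + u1 * im) / rho ^+ 2.
  by field; rewrite !gt_eqF.
have r2 : rho ^+ 2 != 0 by rewrite expf_neq0 // gt_eqF.
split; apply: (mulIf r2); rewrite divfK // -uu /re /im; ring.
Qed.

(** The angle is the sum of the principal angles between consecutive values of
    [f] along the segment from a corner of the rectangle to [p], cut into so
    many steps that consecutive values make acute angles.  Since the rectangle
    is convex this is one formula, continuous in [p]. *)
Lemma angle_lift (f1 f2 : R * R -> R) (a b c d : R) : a <= b -> c <= d ->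
  continuous f1 -> continuous f2 ->
  (forall p, rect a b c d p -> (f1 p, f2 p) <> (0, 0)) ->
  exists2 th : R * R -> R, continuous th &
    forall p, rect a b c d p -> angle_of (f1 p) (f2 p) (th p).
Proof.
move=> ab cd f1c f2c f0.
pose dot p q := f1 p * f1 q + f2 p * f2 q.
have [e e0 He] : exists2 e : R, 0 < e &
    forall p q, rect a b c d p -> ball p e q -> 0 < dot p q.
  apply: lebesgue_pairs; first exact: rect_compact.
  move=> x Kx.
  have dotc : {for (x, x), continuous (fun p : (R * R) * (R * R) => dot p.1 p.2)}.
    by rewrite /dot; cont.
  have dot0 : 0 < dot x x.
    rewrite /dot -!expr2 lt_neqAle addr_ge0 ?sqr_ge0 // andbT eq_sym.
    rewrite paddr_eq0 ?sqr_ge0 // !sqrf_eq0; apply/andP => -[/eqP u10 /eqP u20].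
    by apply: (f0 x Kx); rewrite u10 u20.
  exact: (cvgr_gt (dot x x) dotc _ dot0).
pose N := (Num.truncn ((b - a + (d - c)) / e)).+1.
have N0 : 0 < N%:R :> R by rewrite ltr0n.
have Ne : (b - a + (d - c)) / N%:R < e.
  rewrite ltr_pdivrMr // mulrC -ltr_pdivrMr //; apply: truncnS_gt.
pose q (i : nat) (p : R * R) : R * R :=
  (a + i%:R / N%:R * (clamp a b p.1 - a), c + i%:R / N%:R * (clamp c d p.2 - c)).
have qc i : continuous (q i).
  by move=> p; rewrite /q; cont.
have Kq i p : (i <= N)%N -> rect a b c d (q i p).
  move=> iN; apply/rectP => /=.
  have /andP[l1 l2] := clamp_itv p.1 ab.
  have /andP[l3 l4] := clamp_itv p.2 cd.
  have i0 : 0 <= i%:R / N%:R :> R by rewrite divr_ge0 // ler0n.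
  have i1 : i%:R / N%:R <= 1 :> R by rewrite ler_pdivrMr // mul1r ler_nat.
  by split; nra.
have qstep i p : (i < N)%N -> 0 < dot (q i p) (q i.+1 p).
  move=> iN; apply: He; first exact: Kq (ltnW iN).
  have /andP[l1 l2] := clamp_itv p.1 ab.
  have /andP[l3 l4] := clamp_itv p.2 cd.
  have Ni : 0 < N%:R^-1 :> R by rewrite invr_gt0.
  have iS : i.+1%:R / N%:R = i%:R / N%:R + N%:R^-1 :> R.
    by rewrite -natr1 mulrDl mul1r.
  have E (t u : R) : t + i%:R / N%:R * u - (t + i.+1%:R / N%:R * u) = - (u / N%:R).
    by rewrite iS; ring.
  split=> /=; rewrite /ball /= E normrN normrM ger0_norm ?subr_ge0 //;
    rewrite [X in _ * X]gtr0_norm //; apply: le_lt_trans Ne; rewrite ler_pM2r //; lra.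
have p0K : rect a b c d (a, c) by apply/rectP; rewrite /= !lexx ab cd.
have [th0 th0E] := angle_exists (f0 _ p0K).
pose turn i p := atan ((f1 (q i p) * f2 (q i.+1 p) - f2 (q i p) * f1 (q i.+1 p))
  / dot (q i p) (q i.+1 p)).
have H m p : (m <= N)%N ->
    angle_of (f1 (q m p)) (f2 (q m p)) (th0 + \sum_(i < m) turn i p).
  elim: m => [_|m IH mN].
    by rewrite big_ord0 addr0 /q !mul0r !addr0.
  rewrite big_ord_recr /= addrA /turn.
  by apply: angle_step; [exact: qstep | exact: IH (ltnW mN)].
exists (fun p => th0 + \sum_(i < N) turn i p).
  move=> p; apply: continuous_at_add; first exact: continuous_at_cst.
  apply: continuous_at_sum => i; apply: continuous_at_comp; first exact: continuous_atan.
  apply: continuous_at_mul; last apply: continuous_at_inv.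
  - by cont; exact: qc.
  - by rewrite gt_eqF // qstep.
  - by rewrite /dot; cont; exact: qc.
move=> p /rectP [p1 p2].
have qN : q N p = p.
  rewrite /q !clamp_id // divff ?gt_eqF // !mul1r !addrA ![_ + _ - _]addrAC !subrr !add0r.
  by case: p {p1 p2}.
by have := H N p (leqnn N); rewrite qN.
Qed.

(** The complex cosine of [w], a covering of the plane branched over the two
    punctures only, in the coordinates [x = re w] and [r = exp (- im w)]. *)
Definition cosine_lift (X Y x r : R) : Prop :=
  [/\ 0 < r, X = (r + r^-1) / 2 * cos x & Y = (r - r^-1) / 2 * sin x].

(** With [z = X + iY], a continuous square root [v] of [z^2 - 1] comes from an
    angle of [z^2 - 1], and [z + v] is nonzero since its product with [z - v]
    is 1. Its modulus and angle are [r] and [x]. *)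
Lemma cosine_lift_rect (X Y : R * R -> R) (a b c d : R) : a <= b -> c <= d ->
  continuous X -> continuous Y ->
  (forall p, rect a b c d p -> Y p = 0 -> X p ^+ 2 <> 1) ->
  exists x r : R * R -> R, [/\ continuous x, continuous r &
    forall p, rect a b c d p -> cosine_lift (X p) (Y p) (x p) (r p)].
Proof.
move=> ab cd Xc Yc XY.
pose f1 p := X p ^+ 2 - Y p ^+ 2 - 1; pose f2 p := 2 * X p * Y p.
have f1c : continuous f1 by move=> p; rewrite /f1; cont.
have f2c : continuous f2 by move=> p; rewrite /f2; cont.
have [|phi phic phiE] := angle_lift ab cd f1c f2c.
  move=> p Kp [f10 f20].
  have /eqP := f20; rewrite /f2 !mulf_eq0 pnatr_eq0 /= => /orP[|] /eqP X0.
    by move: f10 (sqr_ge0 (Y p)); rewrite /f1 X0 expr0n /=; lra.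
  by apply: (XY p Kp X0); move: f10; rewrite /f1 X0; lra.
pose s p := Num.sqrt (Num.sqrt (f1 p ^+ 2 + f2 p ^+ 2)).
pose v1 p := s p * cos (phi p / 2); pose v2 p := s p * sin (phi p / 2).
pose z1 p := X p + v1 p; pose z2 p := Y p + v2 p.
have z1c : continuous z1 by move=> p; rewrite /z1 /v1 /s; cont.
have z2c : continuous z2 by move=> p; rewrite /z2 /v2 /s; cont.
have vE p : rect a b c d p -> v1 p ^+ 2 - v2 p ^+ 2 = f1 p /\ 2 * v1 p * v2 p = f2 p.
  move=> Kp; have [rho rho0 [E1 E2]] := phiE p Kp.
  have s2 : s p ^+ 2 = rho.
    rewrite /s sqr_sqrtr ?sqrtr_ge0 // E1 E2 !exprMn -mulrDr cos2Dsin2 mulr1.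
    by rewrite sqrtr_sqr gtr0_norm.
  have ph : phi p = phi p / 2 + phi p / 2 by lra.
  rewrite E1 E2 /v1 /v2 -s2 [in cos (phi p)]ph [in sin (phi p)]ph cosD sinD.
  by split; ring.
have zv p : rect a b c d p ->
    z1 p * (X p - v1 p) - z2 p * (Y p - v2 p) = 1 /\
    z1 p * (Y p - v2 p) + z2 p * (X p - v1 p) = 0.
  move=> /vE [E1 E2]; rewrite /z1 /z2; split.
    transitivity (X p ^+ 2 - Y p ^+ 2 - (v1 p ^+ 2 - v2 p ^+ 2)); first by ring.
    by rewrite E1 /f1; ring.
  transitivity (2 * X p * Y p - 2 * v1 p * v2 p); first by ring.
  by rewrite E2 /f2; ring.
have z0 p : rect a b c d p -> (z1 p, z2 p) <> (0, 0).
  by move=> /zv [E _] [z10 z20]; move: E; rewrite z10 z20; lra.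
have [x xc xE] := angle_lift ab cd z1c z2c z0.
exists x, (fun p => Num.sqrt (z1 p ^+ 2 + z2 p ^+ 2)); split => //.
  by move=> p; cont.
move=> p Kp; have [rho rho0 [E1 E2]] := xE p Kp.
have cs := cos2Dsin2 (x p).
have -> : Num.sqrt (z1 p ^+ 2 + z2 p ^+ 2) = rho.
  by rewrite E1 E2 !exprMn -mulrDr cs mulr1 sqrtr_sqr gtr0_norm.
have [] := zv p Kp; rewrite E1 E2; set A := X p - v1 p; set B := Y p - v2 p.
move=> Z1 Z2.
have w1 : A = rho^-1 * cos (x p).
  apply: (mulfI (lt0r_neq0 rho0)); rewrite mulrA divff ?gt_eqF // mul1r.
  transitivity (cos (x p) * (rho * cos (x p) * A - rho * sin (x p) * B)
      + sin (x p) * (rho * cos (x p) * B + rho * sin (x p) * A)).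
    by rewrite -[LHS]mulr1 -cs; ring.
  by rewrite Z1 Z2 mulr1 mulr0 addr0.
have w2 : B = - (rho^-1 * sin (x p)).
  apply: (mulfI (lt0r_neq0 rho0)); rewrite mulrN mulrA divff ?gt_eqF // mul1r.
  transitivity (cos (x p) * (rho * cos (x p) * B + rho * sin (x p) * A)
      - sin (x p) * (rho * cos (x p) * A - rho * sin (x p) * B)).
    by rewrite -[LHS]mulr1 -cs; ring.
  by rewrite Z1 Z2 mulr1 mulr0 sub0r.
rewrite /A in w1; rewrite /B in w2.
rewrite /z1 in E1; rewrite /z2 in E2.
by split => //; lra.
Qed.

End Angles.

(** * Counting the sticks of a polygon *)

Section RealLine.
Context {R : realType}.

Lemma ivt (f : R -> R) (a b v : R) : a <= b -> continuous f ->
  f a <= v <= f b \/ f b <= v <= f a -> exists2 c : R, a <= c <= b & f c = v.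
Proof.
move=> ab fc H.
have [||c] := @IVT R f a b v ab; last by exists c.
- exact: continuous_subspaceT.
- rewrite ge_min le_max.
  by case: H => /andP[-> ->]; rewrite ?orbT.
Qed.

Lemma sin_natpi (m : nat) (x : R) : sin (m%:R * pi + x) = (-1) ^+ m * sin x.
Proof. by rewrite addrC mulr_natl (alternatingn (@sinDpi R)). Qed.

Lemma cos_natpi (m : nat) (x : R) : cos (m%:R * pi + x) = (-1) ^+ m * cos x.
Proof. by rewrite addrC mulr_natl (alternatingn (@cosDpi R)). Qed.

Lemma sign_or (m : nat) : (-1) ^+ m = 1 :> R \/ (-1) ^+ m = -1 :> R.
Proof. by rewrite -signr_odd; case: (odd m); rewrite ?expr1 ?expr0; [right|left]. Qed.

Lemma pi_pos : 0 < pi :> R. Proof. exact: pi_gt0. Qed.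

End RealLine.

Section StickCount.
Context {R : realType}.

Definition affine_on (f : R -> R) (a b : R) : Prop :=
  forall s : R, 0 <= s <= 1 -> f ((1 - s) * a + s * b) = (1 - s) * f a + s * f b.

Lemma affine_onE f (a b c : R) : a < b -> affine_on f a b -> a <= c <= b ->
  f c = f a + (c - a) / (b - a) * (f b - f a).
Proof.
move=> ab fab /andP[ac cb].
have ba : 0 < b - a by rewrite subr_gt0.
rewrite -[in LHS](_ : (1 - (c - a) / (b - a)) * a + (c - a) / (b - a) * b = c).
  rewrite fab; first by ring.
  by rewrite divr_ge0 ?(ltW ba) ?subr_ge0 //= ler_pdivrMr // mul1r lerD2r.
by field; rewrite gt_eqF.
Qed.

Lemma affine_on_zeros f (a b c1 c2 c : R) : affine_on f a b -> a <= c1 -> c1 < c2 ->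
  c2 <= b -> f c1 = 0 -> f c2 = 0 -> a <= c <= b -> f c = 0.
Proof.
move=> fab ac1 c12 c2b f1 f2 cab.
have ab : a < b by lra.
have ba : 0 < b - a by rewrite subr_gt0.
have E c' := @affine_onE f a b c' ab fab.
have E1 := E c1; have E2 := E c2; rewrite f1 in E1; rewrite f2 in E2.
have {}E1 : 0 = f a + (c1 - a) / (b - a) * (f b - f a) by apply: E1; lra.
have {}E2 : 0 = f a + (c2 - a) / (b - a) * (f b - f a) by apply: E2; lra.
have D : (c2 - c1) / (b - a) * (f b - f a) = 0.
  transitivity (0 - 0 : R); last by rewrite subrr.
  by rewrite {1}E2 E1; field; rewrite gt_eqF.
have D0 : f b - f a = 0.
  by apply/eqP; move/eqP: D; rewrite mulf_eq0 gt_eqF // divr_gt0 // subr_gt0.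
have fa0 : f a = 0 by move: E1; rewrite D0 mulr0 addr0.
by rewrite E // D0 fa0 mulr0 addr0.
Qed.

Lemma cosine_lift_pi (X Y x r : R) (m : nat) : cosine_lift X Y x r ->
  x = m%:R * pi :> R -> Y = 0 /\ exists2 C : R, 1 <= C & X = (-1) ^+ m * C.
Proof.
move=> [r0 -> ->] ->; rewrite -[_ * pi]addr0 sin_natpi cos_natpi sin0 cos0.
split; first by rewrite !mulr0.
exists ((r + r^-1) / 2); last by rewrite mulr1 mulrC.
have rr : r * r^-1 = 1 by rewrite divff // gt_eqF.
have ri : 0 < r^-1 by rewrite invr_gt0.
by have := sqr_ge0 (r - r^-1); nra.
Qed.

(** Over the horizontal axis, away from the multiples of pi, the lift has
    [r = 1], which is the slit between the punctures. *)
Lemma cosine_lift_slit (X Y x r : R) : cosine_lift X Y x r -> Y = 0 ->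
  sin x != 0 -> X ^+ 2 < 1.
Proof.
move=> [r0 XE YE] Y0 sx.
have rr : r * r^-1 = 1 by rewrite divff // gt_eqF.
have E : r = r^-1.
  have /eqP := esym YE; rewrite Y0 mulf_eq0 (negbTE sx) orbF => /eqP; lra.
have r2 : r ^+ 2 = 1 by rewrite expr2 {2}E rr.
have r1 : r = 1.
  move: r2 => /eqP; rewrite sqrf_eq1 => /orP[/eqP->//|/eqP rN].
  by move: r0; rewrite rN; lra.
rewrite XE r1 invr1 divff ?pnatr_eq0 // mul1r cos2sin2.
by rewrite ltrBlDr ltrDl lt_neqAle eq_sym sqrf_eq0 sx sqr_ge0.
Qed.

(** A plane path from [(1, 0)] to [(-1, 0)], otherwise avoiding these two
    points, together with a lift of its part over [[e, 1 - e]]. *)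
Record lifted_path (X Y x r : R -> R) (e : R) : Prop := LiftedPath {
  path_X : continuous X;
  path_x : continuous x;
  path_e : 0 < e;
  path_X0 : X 0 = 1;
  path_Y0 : Y 0 = 0;
  path_Y1 : Y 1 = 0;
  path_avoids : forall s : R, 0 < s < 1 -> Y s = 0 -> X s ^+ 2 <> 1;
  path_lift : forall s : R, e <= s <= 1 - e ->
    cosine_lift (X s) (Y s) (x s) (r s) }.

(** Reaching pi means reaching the axis beyond the second puncture, although the
    stick starts on the axis at the first one. *)
Lemma first_stick (X Y x r : R -> R) (e a b : R) : lifted_path X Y x r e ->
  affine_on Y 0 a -> e <= b -> b <= a -> b <= 1 - e ->
  x e < pi -> x b <= pi.
Proof.
move=> [Xc xc e0 X0 Y0 Y1 XY lift] Ya eb ba b1 xe; rewrite leNgt; apply/negP => xb.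
have [|c /andP[ec cb] xcE] := ivt (v := pi) eb xc; first by left; rewrite !ltW.
have cltb : c < b.
  by rewrite lt_neqAle cb andbT; apply/eqP => E; move: xb; rewrite -E xcE ltxx.
have [Yc [C C1 XC]] := cosine_lift_pi (m := 1) (lift c ltac:(lra))
  ltac:(by rewrite xcE mul1r).
have Yz (s : R) : 0 <= s <= a -> Y s = 0.
  by move=> ?; apply: (@affine_on_zeros Y 0 a 0 c) => //; lra.
have [|||c' c'c X'] := @ivt _ X 0 c (-1) => //; [lra|right; rewrite X0 XC; lra|].
have c'0 : c' != 0 by apply/eqP => E; move: X'; rewrite E X0; lra.
apply: (XY c'); last by rewrite X' sqrrN expr1n.
  by move: c'0; rewrite neq_lt => /orP[?|?]; lra.
by apply: Yz; lra.
Qed.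

(** Two consecutive multiples of pi lie over the axis beyond opposite punctures,
    so a stick through both runs along the axis from one side to the other. *)
Lemma middle_stick (X Y x r : R -> R) (e t t' a b : R) (m : nat) :
  lifted_path X Y x r e -> affine_on Y t t' ->
  t <= a -> b <= t' -> e <= a -> a <= b -> b <= 1 - e ->
  x a <= m%:R * pi -> x b <= m.+1%:R * pi.
Proof.
move=> [Xc xc e0 X0 Y0 Y1 XY lift] Ya ta bt ea ab b1 xa; rewrite leNgt; apply/negP => xb.
have p0 := pi_pos (R := R).
have mS : m.+1%:R = m%:R + 1 :> R by rewrite -natr1.
have [|c1 c1ab xc1] := ivt (v := m%:R * pi) ab xc.
  by left; move: xb; rewrite mS => xb; apply/andP; split; nra.
have [||c2 c2ab xc2] := @ivt _ x c1 b (m.+1%:R * pi) _ xc.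
- by lra.
- by left; rewrite xc1 mS; apply/andP; split; [nra|rewrite -mS ltW].
have c12 : c1 < c2.
  rewrite lt_neqAle andbC (_ : c1 <= c2) /=; last by lra.
  by apply/eqP => E; move: xc2; rewrite -E xc1 mS; nra.
have [Yc1 [C1 C11 XC1]] := cosine_lift_pi (lift c1 ltac:(lra)) xc1.
have [Yc2 [C2 C21 XC2]] := cosine_lift_pi (lift c2 ltac:(lra)) xc2.
have [c cc Xc1] : exists2 c : R, c1 <= c <= c2 & X c = 1.
  apply: ivt => //; first exact: ltW.
  rewrite XC1 XC2 exprS; have [->|->] := sign_or (R := R) m.
  - by right; lra.
  - by left; lra.
apply: (XY c); last by rewrite Xc1 expr1n.
  by lra.
by apply: (@affine_on_zeros Y t t' c1 c2) => //; lra.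
Qed.

(** A stick that ends on the axis and meets it beyond the punctures stays there,
    while [x] can grow past a multiple of pi along the axis only on the slit. *)
Lemma last_stick (X Y x r : R -> R) (e a b : R) (m : nat) :
  lifted_path X Y x r e -> affine_on Y a 1 ->
  e <= a -> a <= b -> b <= 1 - e -> x a <= m%:R * pi -> x b <= m%:R * pi.
Proof.
move=> [Xc xc e0 X0 Y0 Y1 XY lift] Ya ea ab b1 xa; rewrite leNgt; apply/negP => xb.
have p0 := pi_pos (R := R).
have [|c1 c1ab xc1] := ivt (v := m%:R * pi) ab xc; first by left; rewrite xa ltW.
have c1b : c1 < b.
  rewrite lt_neqAle andbC (_ : c1 <= b) /=; last by lra.
  by apply/eqP => E; move: xb; rewrite -E xc1 ltxx.
have [Yc1 [C1 C11 XC1]] := cosine_lift_pi (lift c1 ltac:(lra)) xc1.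
have Yz (s : R) : a <= s <= 1 -> Y s = 0.
  by move=> ?; apply: (@affine_on_zeros Y a 1 c1 1) => //; lra.
pose w := Num.min (x b - m%:R * pi) (pi / 2).
have w0 : 0 < w by rewrite lt_min subr_gt0 xb divr_gt0.
have wp : w <= pi / 2 by rewrite ge_min lexx orbT.
have wb : w <= x b - m%:R * pi by rewrite ge_min lexx.
have [||c2 c2ab xc2] := @ivt _ x c1 b (m%:R * pi + w) _ xc.
- by lra.
- by left; rewrite xc1; lra.
have sx : sin (x c2) != 0.
  by rewrite xc2 sin_natpi mulf_neq0 ?signr_eq0 // gt_eqF // sin_gt0_pi //; lra.
have X2 := cosine_lift_slit (lift c2 ltac:(lra)) (Yz c2 ltac:(lra)) sx.
have X2c : continuous (fun s => X s ^+ 2) by move=> s; cont.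
have [||c cc Xc1] := @ivt _ _ c1 c2 1 _ X2c.
- by lra.
- right; rewrite (ltW X2) XC1 exprMn sqrr_sign mul1r /=; nra.
apply: (XY c) => //; first by lra.
by apply: Yz; lra.
Qed.

(** Each stick but the first and the last advances [x] past at most one further
    multiple of pi, and these two past none. *)
Lemma stick_count (X Y x r : R -> R) (e : R) (k N : nat) (t : nat -> R) :
  lifted_path X Y x r e ->
  t 0%N = 0 -> t k = 1 -> (forall i, (i < k)%N -> t i < t i.+1) ->
  (forall i, (i < k)%N -> affine_on Y (t i) (t i.+1)) ->
  e <= t 1%N -> t k.-1 <= 1 - e -> e <= 1 - e ->
  x e < pi / 2 -> (2 * N)%:R * pi + pi / 2 < x (1 - e) -> (0 < N)%N ->
  (2 * N + 2 <= k)%N.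
Proof.
move=> H t0 tk tlt Ya et1 tke ee xe x1 N0.
have e0 := path_e H.
have p0 := pi_pos (R := R).
have k0 : (0 < k)%N by case: (k) t0 tk => // ->; lra.
have tle i j : (i <= j)%N -> (j <= k)%N -> t i <= t j.
  move=> ij; elim: j ij => [|j IH]; first by rewrite leqn0 => /eqP ->.
  rewrite leq_eqVlt => /orP[/eqP -> //|ij] jk.
  by apply: le_trans (ltW (tlt j jk)); apply: IH => //; exact: ltnW.
have xe' : x e < pi by lra.
have [k1|k1] := leqP k 1.
  have kE : k = 1%N by apply/eqP; rewrite eqn_leq k1.
  rewrite kE in tk tke.
  have : x (1 - e) <= pi.
    apply: (@first_stick _ _ _ _ _ (t 1%N) _ H) => //; last by rewrite tk; lra.
    by rewrite -t0; apply: Ya.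
  have : 1 <= (2 * N)%:R :> R by rewrite ler1n muln_gt0.
  by nra.
have xi i : (0 < i)%N -> (i < k)%N -> x (t i) <= i%:R * pi.
  elim: i => // -[|i] IH _ ik.
    rewrite mul1r; apply: (@first_stick _ _ _ _ _ (t 1%N) _ H) => //.
      by rewrite -t0; apply: Ya.
    by apply: le_trans tke; apply: tle; rewrite ?leq_pred // -ltnS prednK.
  apply: (@middle_stick _ _ _ _ _ (t i.+1) (t i.+2) (t i.+1) _ _ H) => //.
  - by apply: Ya; exact: ltnW.
  - by apply: le_trans et1 _; apply: tle => //; exact: ltnW (ltnW ik).
  - by apply: ltW; apply: tlt; exact: ltnW.
  - by apply: le_trans tke; apply: tle; rewrite ?leq_pred // -ltnS prednK.
  - by apply: IH => //; exact: ltnW.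
have : x (1 - e) <= k.-1%:R * pi.
  apply: (@last_stick _ _ _ _ _ (t k.-1) _ _ H) => //.
  - by rewrite -tk -{2}(prednK k0); apply: Ya; rewrite prednK.
  - by apply: le_trans et1 _; apply: tle; rewrite ?leq_pred // -ltnS prednK.
  - by apply: xi; rewrite ?prednK // -ltnS prednK.
move=> x1'; rewrite leqNgt; apply/negP => kN.
have : k.-1%:R <= (2 * N)%:R :> R.
  by rewrite ler_nat -ltnS prednK // -ltnS (leq_trans kN) // addn2.
by nra.
Qed.

End StickCount.

(** * Height and polar coordinates of the winding arc *)

Section WindingArc.
Context {R : realType}.

(** The inverse is continuous because increasing functions carry the intervals
    that serve as neighbourhoods to intervals. *)
Lemma increasing_inverse (f : R -> R) : continuous f ->
  (forall a b : R, a < b -> f a < f b) ->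
  (forall y, exists x, f x <= y) -> (forall y, exists x, y <= f x) ->
  exists g : R -> R, [/\ continuous g, cancel f g & cancel g f].
Proof.
move=> fc finc flo fhi.
have flt a b : (f a < f b) = (a < b).
  have [ab|ab|->] := ltgtP a b; last by rewrite ltxx.
    exact: finc.
  by apply/negbTE; rewrite -leNgt ltW // finc.
have fle a b : (f a <= f b) = (a <= b) by rewrite !leNgt flt.
have ex y : exists x, f x = y.
  have [a fa] := flo y; have [b fb] := fhi y.
  have ab : a <= b by rewrite -fle (le_trans fa fb).
  by have [|c _ <-] := ivt (v := y) ab fc; [left; rewrite fa|exists c].
have [g gK] := choice ex.
exists g; split=> // [y|x].
  apply/cvgrPdist_lt => e e0.
  have [lo hi] : f (g y - e) < y /\ y < f (g y + e).
    by rewrite -{2 3}(gK y) !flt; split; lra.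
  near=> z.
  have z1 : f (g y - e) < z by near: z; exact: lt_nbhsr.
  have z2 : z < f (g y + e) by near: z; exact: lt_nbhsl.
  by move: z1 z2; rewrite -{1 2}(gK z) !flt => ? ?; rewrite ltr_norml; lra.
by apply/eqP; rewrite eq_le -fle gK lexx /= -fle gK lexx.
Unshelve. all: by end_near. Qed.

(** Slope -1 beyond the ends extends the height function of the arc to the whole
    line.  Its inverse recovers the parameter of the arc from the height. *)
Lemma height_extension (h : R -> R) (E : R) : 0 < E ->
  {within `[0, E], continuous h} ->
  (forall a b : R, 0 <= a -> a < b -> b <= E -> h b < h a) ->
  exists hx eta : R -> R, [/\ continuous hx, continuous eta, cancel hx eta,
    cancel eta hx & (forall u : R, 0 <= u <= E -> hx u = h u) /\
    (forall a b : R, a < b -> hx b < hx a)].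
Proof.
move=> E0 hc hdec.
have E0' := ltW E0.
pose f u := u - clamp 0 E u - h (clamp 0 E u).
have hcc : continuous (fun u => h (clamp 0 E u)).
  apply: (within_comp hc); first exact: clamp_cont.
  by move=> u; rewrite /= in_itv /=; exact: clamp_itv.
have fc : continuous f by move=> u; rewrite /f; cont; exact: hcc.
have flo u : u <= 0 -> f u = u - h 0.
  by move=> u0; rewrite /f clamp_lo // subr0.
have fhi u : E <= u -> f u = u - E - h E.
  by move=> u0; rewrite /f clamp_hi.
have fmid u : 0 <= u <= E -> f u = - h u.
  by move=> u0; rewrite /f clamp_id // subrr sub0r.
have finc a b : a < b -> f a < f b.
  move=> ab.
  have hw c d : 0 <= c -> c <= d -> d <= E -> h d <= h c.
    move=> c0; rewrite le_eqVlt => /orP[/eqP -> //|cd] dE.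
    by apply: ltW; exact: hdec.
  have [a0|a0] := ltP a 0.
    rewrite flo ?(ltW a0) //; have [b0|b0] := ltP b 0.
      by rewrite flo ?(ltW b0) //; lra.
    have [bE|bE] := leP b E; first by rewrite fmid ?b0 //; have := hw 0 b; lra.
    by rewrite fhi ?(ltW bE) //; have := hw 0 E; lra.
  have [aE|aE] := leP a E; last by rewrite !fhi //; lra.
  rewrite fmid ?a0 //; have [bE|bE] := leP b E.
    by rewrite fmid ?bE ?(le_trans a0 (ltW ab)) // ltrN2; exact: hdec.
  by rewrite fhi ?(ltW bE) //; have := hw a E; lra.
have [y|y|g [gc fK gK]] := increasing_inverse fc finc.
- exists (Num.min 0 (y + h 0)); rewrite flo ?ge_min ?lexx //.
  by rewrite lerBlDr ge_min lexx orbT.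
- exists (Num.max E (y + E + h E)); rewrite fhi ?le_max ?lexx //.
  by rewrite !lerBrDr le_max (_ : y + h E + E = y + E + h E) ?lexx ?orbT //; ring.
exists (fun u => - f u), (fun z => g (- z)); split.
- by move=> u; cont.
- by move=> z; cont.
- by move=> u; rewrite opprK fK.
- by move=> z; rewrite gK opprK.
- split=> [u u0|a b ab]; first by rewrite fmid // opprK.
  by rewrite ltrN2 finc.
Qed.

Definition winding_sign (n : int) : R := (sgz n)%:~R.
Definition winding_radius (n : int) (u : R) : R :=
  1 + Num.min (u / pi) (winding_end R n - u).
Definition winding_angle (n : int) (u : R) : R := Num.min u (spiral_end R n).

Variable n : int.
Notation S := (spiral_end R n).
Notation E := (winding_end R n).
Notation N := `|n|%N.
Notation sg := (winding_sign n).

Lemma spiral_endE : S = (2 * N + 1)%:R * pi + 0.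
Proof. by rewrite addr0. Qed.

Lemma cos_spiral_end : cos S = -1.
Proof.
by rewrite spiral_endE cos_natpi cos0 mulr1 addn1 exprS exprM sqrrN !expr1n mulr1.
Qed.

Lemma sin_spiral_end : sin S = 0.
Proof. by rewrite spiral_endE sin_natpi sin0 mulr0. Qed.

Lemma spiral_end_gt0 : 0 < S.
Proof. by rewrite /spiral_end mulr_gt0 ?pi_pos // ltr0n addn1. Qed.

Lemma winding_end_gt : S < E.
Proof. by rewrite /winding_end ltrDl ltr0n addn1. Qed.

Lemma winding_end_gt0 : 0 < E.
Proof. exact: lt_trans spiral_end_gt0 winding_end_gt. Qed.

Lemma winding_radius_gt1 u : 0 < u < E -> 1 < winding_radius n u.
Proof.
move=> /andP[u0 uE].
by rewrite /winding_radius ltrDl lt_min divr_gt0 ?pi_pos // subr_gt0.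
Qed.

Lemma winding_radius_ge1 u : 0 <= u <= E -> 1 <= winding_radius n u.
Proof.
move=> /andP[u0 uE].
by rewrite /winding_radius lerDl le_min subr_ge0 uE andbT divr_ge0 ?pi_ge0.
Qed.

Lemma winding_radius0 : winding_radius n 0 = 1.
Proof.
by rewrite /winding_radius mul0r subr0 (min_idPl (ltW winding_end_gt0)) addr0.
Qed.

Lemma winding_radiusE : winding_radius n E = 1.
Proof.
rewrite /winding_radius subrr (min_idPr _) ?addr0 // divr_ge0 ?pi_ge0 // ltW //.
exact: winding_end_gt0.
Qed.

Lemma winding_angle0 : winding_angle n 0 = 0.
Proof. by rewrite /winding_angle (min_idPl (ltW spiral_end_gt0)). Qed.

Lemma winding_angleE : winding_angle n E = S.
Proof. by rewrite /winding_angle (min_idPr (ltW winding_end_gt)). Qed.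

(** At [u = S] the two arguments of each minimum agree, which is where the two
    branches of the definition meet. *)
Lemma winding_polar u : u <= E ->
  winding_x n u = winding_radius n u * cos (winding_angle n u) /\
  winding_y n u = sg * (winding_radius n u * sin (winding_angle n u)).
Proof.
move=> uE; rewrite /winding_x /winding_y /winding_radius /winding_angle.
have p0 := pi_pos (R := R).
have ES : E = S + (2 * N + 1)%:R by [].
have [uS|Su] := leP u S.
  rewrite (min_idPl _) // ler_pdivrMr //.
  have : u / pi <= (2 * N + 1)%:R by rewrite ler_pdivrMr.
  by rewrite ES => H; rewrite -ler_pdivrMr //; lra.
rewrite (min_idPr _); last first.
  have : (2 * N + 1)%:R < u / pi by rewrite ltr_pdivlMr.
  by rewrite ES => H; lra.
by rewrite cos_spiral_end sin_spiral_end; split; ring.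
Qed.

Lemma winding_sign_sqr : n != 0 -> sg * sg = 1.
Proof.
by rewrite /winding_sign; case: sgzP => // _ _; rewrite ?mulr1 ?mulrNN ?mulr1.
Qed.

End WindingArc.

(** * Invariance of the swept angle *)

Section AngleTraps.
Context {R : realType}.

(** The open arcs on which a cosine is positive trap a continuous angle. *)
Lemma angle_trap (f : R -> R) (a b : R) : a <= b -> continuous f ->
  (forall s : R, a <= s <= b -> 0 < cos (f s)) ->
  `|f a| < pi / 2 -> `|f b| < pi / 2.
Proof.
move=> ab fc fpos fa.
have noval v : cos v = 0 -> ~ (f a <= v <= f b \/ f b <= v <= f a).
  move=> cv /(ivt ab fc) [c cab fcv].
  by have := fpos c cab; rewrite fcv cv ltxx.
move: fa; rewrite !ltr_norml => fa; apply/andP; split; rewrite ltNge; apply/negP => fb.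
  apply: (noval (- (pi / 2))); first by rewrite cosN cos_pihalf.
  by right; lra.
by apply: (noval (pi / 2)); [rewrite cos_pihalf | left; lra].
Qed.

Lemma cos_int2pi (x : R) (j : int) : cos (x - j%:~R * (pi *+ 2)) = cos x.
Proof.
case: j => m.
  have E : x = x - m%:R * (pi *+ 2) + (pi *+ 2) *+ m.
    by rewrite -[in RHS]mulr_natl; ring.
  by rewrite {2}E (periodicn (@cosD2pi R)).
rewrite NegzE mulrNz mulNr opprK.
have -> : m.+1%:~R * (pi *+ 2) = (pi *+ 2) *+ m.+1 :> R by rewrite -[RHS]mulr_natl.
by rewrite (periodicn (@cosD2pi R)).
Qed.

Lemma sin_int2pi (x : R) (j : int) : sin (x - j%:~R * (pi *+ 2)) = sin x.
Proof.
by rewrite -!cosBpihalf addrAC cos_int2pi.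
Qed.

Lemma cos_gt0_small (y : R) : 0 < cos y -> `|y| <= pi -> `|y| < pi / 2.
Proof.
move=> cy yp; have p0 := pi_pos (R := R).
rewrite ltNge; apply/negP => H.
have : cos `|y| <= 0.
  rewrite -[`|y|](subrK (pi / 2)) cosDpihalf oppr_le0 sin_ge0_pi // subr_ge0 H /=.
  by rewrite lerBlDr; lra.
by rewrite cos_norm leNgt cy.
Qed.

Lemma cos_gt0_near (x : R) : 0 < cos x ->
  exists j : int, `|x - j%:~R * (pi *+ 2)| < pi / 2.
Proof.
move=> cx; have p0 := pi_pos (R := R).
have p20 : 0 < pi *+ 2 :> R by rewrite pmulrn_lgt0.
exists (Num.floor ((x + pi) / (pi *+ 2))).
set j := Num.floor _; set y := x - _.
have cy : 0 < cos y by rewrite /y cos_int2pi.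
have /andP[l1 l2] := floor_itv ((x + pi) / (pi *+ 2)).
have {}l1 : j%:~R * (pi *+ 2) <= x + pi by rewrite -ler_pdivlMr.
have {}l2 : x + pi < (j + 1)%:~R * (pi *+ 2) by rewrite -ltr_pdivrMr.
have {}l2 : x + pi < j%:~R * (pi *+ 2) + pi *+ 2.
  by move: l2; rewrite intrD mulrDl mul1r.
have y1 : - pi <= y by rewrite /y; lra.
have y2 : y < pi by rewrite /y; move: l2; rewrite [in X in _ < _ + X]mulr2n; lra.
by apply: cos_gt0_small; rewrite // ler_norml y1 ltW.
Qed.

End AngleTraps.

Section LowerBound.
Context {R : realType}.
Variable n : int.
Notation S := (spiral_end R n).
Notation E := (winding_end R n).
Notation N := `|n|%N.
Notation sg := (winding_sign (R := R) n).

Lemma cosine_lift_flip (X Y x r : R) : cosine_lift X Y x r ->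
  cosine_lift X Y (- x) r^-1.
Proof.
move=> [r0 -> ->]; split; rewrite ?invr_gt0 // invrK ?cosN ?sinN.
  by rewrite addrC.
by ring.
Qed.

Lemma cosine_lift_shift (X Y x r : R) (j : int) : cosine_lift X Y x r ->
  cosine_lift X Y (x - j%:~R * (pi *+ 2)) r.
Proof. by move=> [r0 -> ->]; split; rewrite ?cos_int2pi ?sin_int2pi. Qed.

(** Outside the closed unit disc the lift keeps away from the slit [r = 1]. *)
Lemma cosine_lift_outside (X Y x r : R) : cosine_lift X Y x r ->
  1 < X ^+ 2 + Y ^+ 2 -> r != 1.
Proof.
move=> [r0 -> ->] H; apply/eqP => r1; move: H.
rewrite r1 invr1 subrr !mul0r expr0n /= addr0 divff ?pnatr_eq0 // mul1r cos2sin2.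
by rewrite ltNge gerBl sqr_ge0.
Qed.

(** On the sheet where [r - 1] has the sign of the winding, [x] and the polar
    angle differ by less than a quarter turn modulo full turns. *)
Lemma cosine_lift_polar (rho a x r : R) : 0 < rho -> sg * sg = 1 ->
  0 < sg * (r - 1) ->
  cosine_lift (rho * cos a) (sg * (rho * sin a)) x r -> 0 < cos (x - a).
Proof.
move=> rho0 ss sr [r0 XE YE].
rewrite -(pmulr_rgt0 _ rho0) cosB.
have -> : rho * (cos x * cos a + sin x * sin a)
    = cos x * (rho * cos a) + (sg * sg) * (sin x * (rho * sin a)).
  by rewrite ss; ring.
have -> : (sg * sg) * (sin x * (rho * sin a)) = sg * sin x * (sg * (rho * sin a)).
  by ring.
rewrite XE YE.
have ri : 0 < r^-1 by rewrite invr_gt0.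
have rr : r * r^-1 = 1 by rewrite divff // gt_eqF.
have -> : cos x * ((r + r^-1) / 2 * cos x) + sg * sin x * ((r - r^-1) / 2 * sin x)
    = (r + r^-1) / 2 * cos x ^+ 2 + sg * (r - r^-1) / 2 * sin x ^+ 2 by ring.
have c1 : 0 < (r + r^-1) / 2 by rewrite divr_gt0 // addr_gt0.
have c2 : 0 < sg * (r - r^-1) / 2.
  rewrite divr_gt0 // (_ : sg * _ = sg * (r - 1) * (1 + r^-1)); last first.
    transitivity (sg * (r - r^-1 + (r * r^-1 - 1))); last by ring.
    by rewrite rr subrr addr0.
  by rewrite mulr_gt0 // addr_gt0.
have [c0|c0] := eqVneq (cos x) 0.
  by have := cos2Dsin2 x; rewrite c0 expr0n /= mulr0 !add0r => ->; rewrite mulr1.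
have cp : 0 < cos x ^+ 2 by rewrite lt_neqAle eq_sym sqrf_eq0 c0 sqr_ge0.
apply: ltr_wpDr; last exact: mulr_gt0.
by apply: mulr_ge0; [exact: ltW | exact: sqr_ge0].
Qed.

(** The homotopy lifting argument: a homotopy of plane paths between the two
    punctures, starting at a reparametrized winding arc, ends at a path whose
    lift still sweeps the total angle of the winding arc, up to quarter turns
    near the two punctures. *)
Lemma homotopy_sweep (X Y : R * R -> R) (sigma : R -> R) (e0 : R) :
  n != 0 -> continuous X -> continuous Y -> continuous sigma -> 0 < e0 ->
  (forall t, 0 <= t <= 1 -> X (t, 0) = 1 /\ Y (t, 0) = 0) ->
  (forall t, 0 <= t <= 1 -> X (t, 1) = -1 /\ Y (t, 1) = 0) ->
  (forall t s : R, 0 <= t <= 1 -> 0 < s < 1 -> Y (t, s) = 0 ->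
    X (t, s) ^+ 2 <> 1) ->
  sigma 0 = 0 -> sigma 1 = E ->
  (forall s : R, 0 < s < 1 -> 0 < sigma s < E) ->
  (forall s : R, 0 < s < 1 -> X (0, s) = winding_x n (sigma s) /\
    Y (0, s) = winding_y n (sigma s)) ->
  exists (e : R) (x r : R -> R), [/\ e <= e0, e <= 1 - e,
    lifted_path (fun s => X (1, s)) (fun s => Y (1, s)) x r e, x e < pi / 2 &
    (2 * N)%:R * pi + pi / 2 < x (1 - e)].
Proof.
move=> n0 Xc Yc sc e00 H0 H1 Hint s0 s1 sint XW.
have p0 := pi_pos (R := R).
have ss := winding_sign_sqr (R := R) n0.
have S0 := spiral_end_gt0 (R := R) n.
have SE := winding_end_gt (R := R) n.
(* close to the punctures the sign of [X] and the angle of the winding arc are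
   under control *)
have [d1 d10 Hd1] : exists2 d : R, 0 < d & forall p q, rect 0 1 0 0 p ->
    ball p d q -> 0 < X q /\ sigma q.2 < pi / 2.
  apply: lebesgue_pairs; first exact: rect_compact.
  move=> p /rectP [p1 p2]; have {}p2 : p.2 = 0 by apply/le_anti; rewrite andbC.
  have pE : p = (p.1, 0) by rewrite -p2; case: (p).
  near=> q; split; near: q.
    have c : {for (p, p), continuous (fun q : (R * R) * (R * R) => X q.2)} by cont.
    by apply: (cvgr_gt _ c); rewrite /= pE (H0 _ p1).1.
  have c : {for (p, p), continuous (fun q : (R * R) * (R * R) => sigma q.2.2)}.
    by cont; apply: continuous_at_of; [exact: snd_cont|exact: snd_cont].
  by apply: (cvgr_lt _ c); rewrite /= p2 s0 divr_gt0.
have [d2 d20 Hd2] : exists2 d : R, 0 < d & forall p q, rect 0 1 1 1 p ->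
    ball p d q -> X q < 0 /\ S < sigma q.2.
  apply: lebesgue_pairs; first exact: rect_compact.
  move=> p /rectP [p1 p2]; have {}p2 : p.2 = 1 by apply/le_anti; rewrite andbC.
  have pE : p = (p.1, 1) by rewrite -p2; case: (p).
  near=> q; split; near: q.
    have c : {for (p, p), continuous (fun q : (R * R) * (R * R) => X q.2)} by cont.
    by apply: (cvgr_lt _ c); rewrite /= pE (H1 _ p1).1 oppr_lt0.
  have c : {for (p, p), continuous (fun q : (R * R) * (R * R) => sigma q.2.2)}.
    by cont; apply: continuous_at_of; [exact: snd_cont|exact: snd_cont].
  by apply: (cvgr_gt _ c); rewrite /= p2 s1.
pose e := Num.min (Num.min e0 (1 / 2)) (Num.min (d1 / 2) (d2 / 2)).
have e_gt0 : 0 < e by rewrite !lt_min e00 !divr_gt0.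
have [ee0 e12 ed1 ed2] : [/\ e <= e0, e <= 1 / 2, e <= d1 / 2 & e <= d2 / 2].
  by split; rewrite /e !ge_min lexx ?orbT.
have ee : e <= 1 - e by lra.
have near0 t : 0 <= t <= 1 -> 0 < X (t, e) /\ sigma e < pi / 2.
  move=> t01; apply: (Hd1 (t, 0)); first by apply/rectP; rewrite /= lexx.
  split; first exact: ballxx.
  by rewrite /ball /= sub0r normrN gtr0_norm //; lra.
have near1 t : 0 <= t <= 1 -> X (t, 1 - e) < 0 /\ S < sigma (1 - e).
  move=> t01; apply: (Hd2 (t, 1)); first by apply/rectP; rewrite /= lexx.
  split; first exact: ballxx.
  by rewrite /ball /= opprB addrC subrK gtr0_norm //; lra.
have z01 : 0 <= (0 : R) <= 1 by rewrite lexx ler01.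
have o01 : 0 <= (1 : R) <= 1 by rewrite lexx ler01.
have [x [r [xc rc lift]]] : exists x r : R * R -> R,
    [/\ continuous x, continuous r &
    forall p, rect 0 1 e (1 - e) p -> cosine_lift (X p) (Y p) (x p) (r p)].
  apply: cosine_lift_rect => // -[t s] /rectP [/= t01 s01].
  by apply: Hint => //; lra.
have Ke t s : 0 <= t <= 1 -> e <= s <= 1 - e -> rect 0 1 e (1 - e) (t, s).
  by move=> t01 se; apply/rectP.
have W s : e <= s <= 1 - e ->
    [/\ 1 < winding_radius n (sigma s),
    X (0, s) = winding_radius n (sigma s) * cos (winding_angle n (sigma s)) &
    Y (0, s) = sg * (winding_radius n (sigma s) * sin (winding_angle n (sigma s)))].
  move=> se; have s01 : 0 < s < 1 by lra.
  have [-> ->] := XW s s01.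
  have /andP[g0 gE] := sint s s01.
  have [-> ->] := winding_polar (ltW gE).
  by split => //; apply: winding_radius_gt1; rewrite g0.
have rn1 s : e <= s <= 1 - e -> r (0, s) - 1 != 0.
  move=> se; rewrite subr_eq0; apply: (cosine_lift_outside (lift _ (Ke _ _ z01 se))).
  have [rho1 -> ->] := W s se.
  rewrite !exprMn (expr2 sg) ss mul1r -mulrDr cos2Dsin2 mulr1.
  by rewrite expr_gt1 // ltW // (lt_trans _ rho1).
have rc0 : continuous (fun s => r (0, s) - 1).
  by move=> s; cont; apply: continuous_at_of => //; cont.
have rsgn : (forall s : R, e <= s <= 1 - e -> 0 < r (0, s) - 1) \/
            (forall s : R, e <= s <= 1 - e -> r (0, s) - 1 < 0).
  have noz s s' : e <= s -> s <= s' -> s' <= 1 - e ->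
      ~ (r (0, s) - 1 <= 0 <= r (0, s') - 1 \/ r (0, s') - 1 <= 0 <= r (0, s) - 1).
    move=> es ss' se /(ivt ss' rc0) [c cc rc1].
    have := rn1 c; rewrite rc1 eqxx => H; suff : false by [].
    by apply: H; lra.
  have eKe : e <= e <= 1 - e by rewrite lexx ee.
  have := rn1 e eKe; rewrite neq_lt => /orP[re|re]; [right|left] => s /andP[es se].
    by rewrite ltNge; apply/negP => rs; apply: (noz e s) => //; left; rewrite rs ltW.
  by rewrite ltNge; apply/negP => rs; apply: (noz e s) => //; right; rewrite rs ltW.
(* the deck transformation [(x, r) |-> (- x, 1/r)] leads to the desired sheet,
   and full turns move the start of [x] next to 0 *)
have {x r xc rc lift rn1 rc0 rsgn} [x [r [xc lift rs xe]]] :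
    exists x r : R * R -> R, [/\ continuous x,
    forall p, rect 0 1 e (1 - e) p -> cosine_lift (X p) (Y p) (x p) (r p),
    forall s : R, e <= s <= 1 - e -> 0 < sg * (r (0, s) - 1) &
    `|x (0, e)| < pi / 2].
  have [x2 [r2 [xc2 lift2 rs]]] : exists x r : R * R -> R, [/\ continuous x,
      forall p, rect 0 1 e (1 - e) p -> cosine_lift (X p) (Y p) (x p) (r p) &
      forall s : R, e <= s <= 1 - e -> 0 < sg * (r (0, s) - 1)].
    have [keep|flip] : (forall s : R, e <= s <= 1 - e -> 0 < sg * (r (0, s) - 1)) \/
        (forall s : R, e <= s <= 1 - e -> sg * (r (0, s) - 1) < 0).
      have : (sg - 1) * (sg + 1) = 0 by rewrite -[0](subrr 1) -{3}ss; ring.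
      move/eqP; rewrite mulf_eq0 subr_eq0 addr_eq0.
      by case: rsgn => rsgn /orP[] /eqP ->; [left|right|right|left] => s se;
        rewrite ?mulN1r ?mul1r ?oppr_lt0 ?oppr_gt0; apply: rsgn.
    - by exists x, r.
    - exists (fun p => - x p), (fun p => (r p)^-1); split.
      + by move=> p; cont.
      + by move=> p /lift; exact: cosine_lift_flip.
      move=> s se; have [r0 _ _] := lift _ (Ke _ _ z01 se).
      have -> : sg * ((r (0, s))^-1 - 1) = - (sg * (r (0, s) - 1)) / r (0, s).
        by field; rewrite gt_eqF.
      by rewrite divr_gt0 // oppr_gt0 flip.
  have eKe : e <= e <= 1 - e by rewrite lexx ee.
  have [j xj] : exists j : int, `|x2 (0, e) - j%:~R * (pi *+ 2)| < pi / 2.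
    apply: cos_gt0_near; have [X0 _] := near0 0 z01.
    have [r0 XE _] := lift2 _ (Ke _ _ z01 eKe).
    by move: X0; rewrite XE pmulr_rgt0 // divr_gt0 // addr_gt0 // invr_gt0.
  exists (fun p => x2 p - j%:~R * (pi *+ 2)), r2; split => //.
    by move=> p; cont.
  by move=> p /lift2; exact: cosine_lift_shift.
have eKe : e <= e <= 1 - e by rewrite lexx ee.
have eK1 : e <= 1 - e <= 1 - e by rewrite lexx ee.
have xc' (t s : R -> R) : continuous t -> continuous s ->
    continuous (fun u => x (t u, s u)).
  by move=> tc sc' u; cont.
have idc : continuous (fun u : R => u) by move=> u; exact: cvg_id.
have cc (v : R) : continuous (fun _ : R => v) by move=> u; exact: cvg_cst.
have xe1 : `|x (1, e)| < pi / 2.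
  apply: (@angle_trap _ (fun t => x (t, e)) 0 1) => //; first exact: xc'.
  move=> t t01; have [X0 _] := near0 t t01.
  have [r0 XE _] := lift _ (Ke _ _ t01 eKe).
  by move: X0; rewrite XE pmulr_rgt0 // divr_gt0 // addr_gt0 // invr_gt0.
have x0e : `|x (0, 1 - e) - S| < pi / 2.
  have [_ sS] := near1 0 z01.
  have -> : S = winding_angle n (sigma (1 - e)).
    by rewrite /winding_angle (min_idPr (ltW sS)).
  apply: (@angle_trap _ (fun s => x (0, s) - winding_angle n (sigma s)) e) => //.
  - by move=> u; rewrite /winding_angle; cont; exact: xc'.
  - move=> s se; have [rho1 XE YE] := W s se.
    apply: (@cosine_lift_polar (winding_radius n (sigma s)) _ _ (r (0, s))) => //.
    + exact: lt_trans rho1.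
    + exact: rs.
    + by rewrite -XE -YE; apply: lift; exact: Ke.
  have [_ se] := near0 0 z01.
  have /andP[s_gt0 _] : 0 < sigma e < E by apply: sint; lra.
  have /andP[a0 a1] : 0 < winding_angle n (sigma e) < pi / 2.
    by rewrite /winding_angle lt_min s_gt0 S0 gt_min se.
  apply: cos_gt0_small.
    have [rho1 XE YE] := W e eKe.
    apply: (@cosine_lift_polar (winding_radius n (sigma e)) _ _ (r (0, e))) => //.
    + exact: lt_trans rho1.
    + exact: rs.
    + by rewrite -XE -YE; apply: lift; exact: Ke.
  by move: xe; rewrite ltr_norml ler_norml => ?; lra.
have x1e : `|x (1, 1 - e) - S| < pi / 2.
  apply: (@angle_trap _ (fun t => x (t, 1 - e) - S) 0 1) => //.
    by move=> u; cont; exact: xc'.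
  move=> t t01; have [X0 _] := near1 t t01.
  have [r0 XE _] := lift _ (Ke _ _ t01 eK1).
  rewrite cosB cos_spiral_end sin_spiral_end mulr0 addr0 mulrN1 oppr_gt0.
  by move: X0; rewrite XE pmulr_rlt0 // divr_gt0 // addr_gt0 // invr_gt0.
exists e, (fun s => x (1, s)), (fun s => r (1, s)); split => //.
- split => //.
  + by move=> s; cont.
  + exact: xc'.
  + by have [] := H0 1 o01.
  + by have [] := H0 1 o01.
  + by have [] := H1 1 o01.
  + by move=> s; exact: Hint.
  + by move=> s se; apply: lift; exact: Ke.
- by move: xe1; rewrite ltr_norml => /andP[].
move: x1e; rewrite ltr_norml => /andP[+ _].
have -> : S = (2 * N)%:R * pi + pi by rewrite /spiral_end addn1 -natr1 mulrDl mul1r.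
lra.
Unshelve. all: by end_near. Qed.

End LowerBound.

(** * The lower bound *)

Section LowerBoundTheorem.
Context {R : realType}.
Variable n : int.
Notation S := (spiral_end R n).
Notation E := (winding_end R n).
Notation N := `|n|%N.
Notation sg := (winding_sign (R := R) n).
Notation tail := (tail_rail R).
Notation head := (head_rail R).

Lemma winding_circle (u : R) : n != 0 -> u <= E ->
  winding_x n u ^+ 2 + winding_y n u ^+ 2 = winding_radius n u ^+ 2.
Proof.
move=> n0 uE; have [-> ->] := winding_polar uE.
rewrite !exprMn (expr2 sg) winding_sign_sqr // mul1r -mulrDr cos2Dsin2 mulr1 //.
Qed.

Lemma winding_start : winding_x n (0 : R) = 1 /\ winding_y n (0 : R) = 0.
Proof.
have [-> ->] := winding_polar (ltW (winding_end_gt0 (R := R) n)).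
by rewrite winding_radius0 winding_angle0 cos0 sin0 !mulr1 !mulr0.
Qed.

Lemma winding_finish : winding_x n E = -1 /\ winding_y n E = 0.
Proof.
have [-> ->] := winding_polar (lexx E).
by rewrite winding_radiusE winding_angleE cos_spiral_end sin_spiral_end !mulr0 mul1r.
Qed.

(** All other points of the winding arc are further than 1 from the axis. *)
Lemma winding_on_rails (u : R) : n != 0 -> 0 <= u <= E -> winding_y n u = 0 ->
  winding_x n u ^+ 2 = 1 -> u = 0 \/ u = E.
Proof.
move=> n0 /andP[u0 uE] Y0 X1; have := winding_circle n0 uE.
rewrite X1 Y0 expr0n /= addr0 => rho2.
have [->|un0] := eqVneq u 0; first by left.
have [->|unE] := eqVneq u E; first by right.
have : 1 < winding_radius n u.
  by apply: winding_radius_gt1; rewrite !lt_neqAle eq_sym un0 u0 unE.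
move=> r1; have : 1 < winding_radius n u ^+ 2 by rewrite expr_gt1 // ltW // (lt_trans _ r1).
by rewrite -rho2 ltxx.
Qed.

Lemma convex01 (a b s : R) : 0 <= a -> a < b -> b <= 1 -> 0 <= s <= 1 ->
  0 <= (1 - s) * a + s * b <= 1.
Proof. by move=> a0 ab b1 /andP[s0 s1]; apply/andP; split; nra. Qed.

(** The homotopy ends at the projected stick arc itself: at time [t] it is the
    stick arc pulled back by the final map of the isotopy and then moved by the
    map at time [t].  At time 0 this is the winding arc, run through with the
    parameter [sigma] that the height determines. *)
Theorem winding_sticks_ge (W : set 'rV[R]_3) (k : nat) : n != 0 ->
  winding_rail_arc n W -> stick_presentable tail head W k -> (2 * N + 2 <= k)%N.
Proof.
move=> n0 [h [hc hdec WE]] [_ [gamma [[gc ginj g0 g1 gint] [t [t0 tk tlt gaff]] ->]]].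
move=> [F [[Fc F0 Fh] Frails FW]].
have oc (s : R) : 0 < s < 1 -> 0 <= s <= 1 by move=> /andP[/ltW -> /ltW ->].
have E0 := winding_end_gt0 (R := R) n.
have [hx [eta [hxc etac hxK etaK [hxE hxdec]]]] := height_extension E0 hc hdec.
have o01 : 0 <= (1 : R) <= 1 by rewrite lexx ler01.
have z01 : 0 <= (0 : R) <= 1 by rewrite lexx ler01.
have [_ [g [gcont gK Kg]]] := Fh 1 o01.
have Finj t' : 0 <= t' <= 1 -> injective (F t').
  by move=> /Fh [_ [g' [_ g'K _]]]; exact: can_inj g'K.
have rail (l : set 'rV[R]_3) t' v : 0 <= t' <= 1 -> F t' @` l = l ->
    l (F t' v) <-> l v.
  move=> t01 Fl; split=> [|lv]; last by rewrite -Fl; exists v.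
  by rewrite -{1}Fl => -[w lw /(Finj _ t01) <-].
have railT t' v (t01 : 0 <= t' <= 1) := rail tail t' v t01 (Frails t' t01).1.
have railH t' v (t01 : 0 <= t' <= 1) := rail head t' v t01 (Frails t' t01).2.
pose P (p : R * R) := F (clamp 0 1 p.1) (g (gamma (clamp 0 1 p.2))).
have cl01 (s : R) : 0 <= clamp 0 1 s <= 1 by apply: clamp_itv; exact: ler01.
have gcl : continuous (fun s => gamma (clamp 0 1 s)).
  apply: (within_comp gc); first exact: clamp_cont.
  by move=> s; rewrite /= in_itv /=.
have Pc : continuous P.
  rewrite /P; apply: (within_comp (f := fun p : R * 'rV[R]_3 => F p.1 p.2)
    (g := fun p : R * R => (clamp 0 1 p.1, g (gamma (clamp 0 1 p.2)))) Fc).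
    move=> p; apply: continuous_at_pair; first by cont.
    by apply: (continuous_at_of gcont); apply: (continuous_at_of gcl); exact: snd_cont.
  by move=> p; split; rewrite //= in_itv /=.
pose X p := X_ (P p); pose Y p := Y_ (P p).
have Xc : continuous X by move=> p; rewrite /X; cont.
have Yc : continuous Y by move=> p; rewrite /Y; cont.
pose sigma s := eta (Z_ (g (gamma (clamp 0 1 s)))).
have sc : continuous sigma.
  by move=> s; rewrite /sigma; cont; exact: gcl.
have onW (s : R) : 0 <= s <= 1 -> 0 <= sigma s <= E /\
    g (gamma s) = point3 (winding_x n (sigma s)) (winding_y n (sigma s)) (h (sigma s)).
  move=> s01; rewrite /sigma clamp_id //.
  have : (gamma @` `[0, 1]) (gamma s) by exists s; rewrite //= in_itv /=.
  rewrite -FW => -[w Ww <-]; rewrite gK; move: Ww; rewrite WE => -[u].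
  rewrite /= in_itv /= => uE <-; rewrite Z_point3.
  by have -> : eta (h u) = u by rewrite -hxE // hxK.
have g1K (s : R) : F 1 (g (gamma s)) = gamma s by rewrite Kg.
have tailg (s : R) : tail (gamma s) <-> tail (g (gamma s)).
  by rewrite -{1}g1K; exact: railT.
have headg (s : R) : head (gamma s) <-> head (g (gamma s)).
  by rewrite -{1}g1K; exact: railH.
have sigma0 : sigma 0 = 0.
  have [s01 gE] := onW 0 z01.
  have /vertical_lineE [] := (tailg 0).1 g0; rewrite gE X_point3 Y_point3 => X0 Y0.
  have [|//|sE] := winding_on_rails n0 s01 Y0; first by rewrite X0 expr1n.
  by move: X0; rewrite sE (winding_finish).1; lra.
have sigma1 : sigma 1 = E.
  have [s01 gE] := onW 1 o01.
  have /vertical_lineE [] := (headg 1).1 g1; rewrite gE X_point3 Y_point3 => X0 Y0.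
  have [|s0|//] := winding_on_rails n0 s01 Y0; first by rewrite X0 sqrrN expr1n.
  by move: X0; rewrite s0 (winding_start).1; lra.
have sint (s : R) : 0 < s < 1 -> 0 < sigma s < E.
  move=> s01; have s01' := oc s s01.
  have [/andP[s0 sE] gE] := onW s s01'.
  rewrite !lt_neqAle s0 sE !andbT eq_sym; apply/andP; split; apply/eqP => sv.
    apply: (gint s s01); left; apply/tailg; rewrite gE sv.
    by apply/vertical_lineE; rewrite X_point3 Y_point3; exact: winding_start.
  apply: (gint s s01); right; apply/headg; rewrite gE sv.
  by apply/vertical_lineE; rewrite X_point3 Y_point3; exact: winding_finish.
have P1 (s : R) : 0 <= s <= 1 -> P (1, s) = gamma s.
  by move=> s01; rewrite /P /= !clamp_id.
have t1 (i : nat) : (0 < k)%N.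
  by case: (k) t0 tk => // ->; lra.
have k0 := t1 0%N.
have t1gt : 0 < t 1%N by rewrite -t0; apply: tlt.
have tkl : t k.-1 < 1 by rewrite -tk -{2}(prednK k0); apply: tlt; rewrite prednK.
pose e0 := Num.min (t 1%N) (1 - t k.-1).
have e0_gt0 : 0 < e0 by rewrite lt_min t1gt subr_gt0.
have [e [x [r [ee0 ee lp xe x1]]]] : exists (e : R) (x r : R -> R),
    [/\ e <= e0, e <= 1 - e,
    lifted_path (fun s => X (1, s)) (fun s => Y (1, s)) x r e, x e < pi / 2 &
    (2 * N)%:R * pi + pi / 2 < x (1 - e)].
  apply: (homotopy_sweep (sigma := sigma) (Y := Y)) => //
    [u u01|u u01|u s u01 s01 Y0 X1|s s01].
  - apply/vertical_lineE; rewrite /P /= clamp_id // clamp_id //.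
    by apply/railT => //; apply/tailg.
  - apply/vertical_lineE; rewrite /P /= clamp_id // clamp_id //.
    by apply/railH => //; apply/headg.
  - have s01' := oc s s01.
    have : (tail `|` head) (P (u, s)).
      move/eqP: X1; rewrite sqrf_eq1 => /orP[|] /eqP X1; [left|right];
      exact/vertical_lineE.
    rewrite /P /= (clamp_id u01) (clamp_id s01') => -[] H; apply: (gint s s01).
      by left; apply/tailg; move/railT : H; apply.
    by right; apply/headg; move/railH : H; apply.
  - have s01' := oc s s01.
    have [_ gE] := onW s s01'.
    by rewrite /X /Y /P /= (clamp_id z01) (clamp_id s01') F0 gE X_point3 Y_point3.
have [et et'] : e <= t 1%N /\ t k.-1 <= 1 - e.
  move: ee0; rewrite /e0 le_min => /andP[? ?]; split=> //.
  by rewrite lerBrDr addrC -lerBrDr.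
apply: (stick_count lp t0 tk tlt) => //; last by rewrite absz_gt0.
have tle i j : (i <= j)%N -> (j <= k)%N -> t i <= t j.
  move=> ij; elim: j ij => [|j IH]; first by rewrite leqn0 => /eqP ->.
  rewrite leq_eqVlt => /orP[/eqP -> //|ij] jk.
  by apply: le_trans (ltW (tlt j jk)); apply: IH => //; exact: ltnW.
move=> i ik s s01.
have i0 : 0 <= t i by rewrite -t0; apply: tle => //; exact: ltnW.
have i1 : t i.+1 <= 1 by rewrite -tk; apply: tle.
have iS := tlt i ik.
rewrite /Y !P1 ?gaff ?mxE ?convex01 //.
  by rewrite i1 (le_trans i0 (ltW iS)).
by rewrite i0 (le_trans (ltW iS) i1).
Qed.

End LowerBoundTheorem.

(** * Motions that preserve each height or each vertical line *)

Section Motions.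
Context {R : realType}.
Notation tail := (tail_rail R).
Notation head := (head_rail R).
Implicit Types (F : R -> 'rV[R]_3 -> 'rV[R]_3) (v : 'rV[R]_3).

(** Unlike for an isotopy, continuity is asked for all times.  The motions below
    satisfy this, and it makes composition immediate. *)
Definition rail_motion F : Prop :=
  [/\ continuous (fun p : R * 'rV[R]_3 => F p.1 p.2), forall v, F 0 v = v,
      forall t : R, 0 <= t <= 1 -> homeomorphism (F t) &
      forall t : R, 0 <= t <= 1 -> F t @` tail = tail /\ F t @` head = head].

Lemma rail_motion_isotopic F r : rail_motion F ->
  rail_isotopic tail head r (F 1 @` r).
Proof.
by move=> [Fc F0 Fh Fl]; exists F; split=> //; split=> //; exact: continuous_subspaceT.
Qed.

Lemma rail_motion_comp F G : rail_motion F -> rail_motion G ->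
  rail_motion (fun t v => G t (F t v)).
Proof.
move=> [Fc F0 Fh Fl] [Gc G0 Gh Gl]; split.
- move=> p; apply: (@continuous_at_of _ _ _ (fun p : R * 'rV[R]_3 => G p.1 p.2)
    (fun p => (p.1, F p.1 p.2))) => //.
  by apply: continuous_at_pair; [exact: fst_cont | exact: Fc].
- by move=> v; rewrite F0 G0.
- move=> t t01; have [ftc [f' [f'c fK f'K]]] := Fh t t01.
  have [gtc [g' [g'c gK g'K]]] := Gh t t01; split.
    by move=> v; apply: (continuous_at_of gtc); exact: ftc.
  exists (fun v => f' (g' v)); split.
  + by move=> v; apply: (continuous_at_of f'c); exact: g'c.
  + by move=> v; rewrite gK fK.
  + by move=> v; rewrite f'K g'K.
- move=> t t01; have [fT fH] := Fl t t01; have [gT gH] := Gl t t01.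
  by split; rewrite -(image_comp (F t) (G t)) ?fT ?fH.
Qed.

Definition fixes_rails (f : 'rV[R]_3 -> 'rV[R]_3) : Prop :=
  forall v, X_ v ^+ 2 = 1 -> Y_ v = 0 ->
    X_ (f v) = X_ v /\ Y_ (f v) = Y_ v.

Lemma rail_motion_intro F :
  continuous (fun p : R * 'rV[R]_3 => F p.1 p.2) -> (forall v, F 0 v = v) ->
  (forall t : R, 0 <= t <= 1 -> fixes_rails (F t) /\
    exists G : 'rV[R]_3 -> 'rV[R]_3,
      [/\ continuous G, cancel (F t) G, cancel G (F t) & fixes_rails G]) ->
  rail_motion F.
Proof.
move=> Fc F0 FG; split=> // t /FG [Ff [G [Gc FK GK Gf]]].
  split; last by exists G.
  move=> v; apply: (@continuous_at_of _ _ _ (fun p : R * 'rV[R]_3 => F p.1 p.2)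
    (fun v => (t, v))) => //.
  by apply: continuous_at_pair; [exact: continuous_at_cst|exact: cvg_id].
have img (c : R) : c ^+ 2 = 1 -> F t @` vertical_line c 0 = vertical_line c 0.
  move=> c2; apply/seteqP; split=> v.
    move=> [w /vertical_lineE [wX wY] <-]; apply/vertical_lineE.
    by have [||-> ->] := Ff w; rewrite ?wX ?wY.
  move=> /vertical_lineE [vX vY]; exists (G v); last exact: GK.
  by apply/vertical_lineE; have [||-> ->] := Gf v; rewrite ?vX ?vY.
split; first exact: (img 1 (expr1n _ _)).
have m1 : (-1) ^+ 2 = 1 :> R by rewrite sqrrN expr1n.
exact: (img (-1) m1).
Qed.

(** The fraction of a displacement felt at gauge value [m], when the arc sits at
    gauge value [a]: it grows from the fixed unit ball on and is full from the
    arc on. *)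
Definition ramp (a m : R) : R := Num.min 1 (Num.max (m - 1) 0 / (a - 1)).

Lemma ramp_norm a m : 1 <= a -> `|ramp a m| <= 1.
Proof.
move=> a1; rewrite /ramp ger0_norm ?ge_min ?lexx // le_min ler01 /=.
by rewrite divr_ge0 ?le_max ?lexx ?orbT // subr_ge0.
Qed.

Lemma ramp_in a m : m <= 1 -> ramp a m = 0.
Proof.
move=> m1; rewrite /ramp (max_idPr _) ?subr_le0 // mul0r (min_idPr _) ?ler01 //.
Qed.

Lemma ramp_out a m : 1 < a -> a <= m -> ramp a m = 1.
Proof.
move=> a1 am; have a0 : 0 < a - 1 by rewrite subr_gt0.
rewrite /ramp (max_idPl _); last by rewrite subr_ge0 (le_trans (ltW a1) am).
by rewrite (min_idPl _) // ler_pdivlMr // mul1r lerD2r.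
Qed.

Lemma ramp_mid a m : 1 <= m -> m < a -> ramp a m = (m - 1) / (a - 1).
Proof.
move=> m1 ma; have a0 : 0 < a - 1 by rewrite subr_gt0 (le_lt_trans m1 ma).
rewrite /ramp (max_idPl _) ?subr_ge0 //.
by rewrite (min_idPr _) // ler_pdivrMr // mul1r lerD2r ltW.
Qed.

(** The ramp jumps where the arc meets a puncture, [a = 1], but there the
    displacement [g] vanishes. *)
Lemma continuous_at_ramp (T : topologicalType) (g a m : T -> R) x :
  continuous_at x g -> continuous_at x a -> continuous_at x m ->
  (forall y, 1 <= a y) -> (a x = 1 -> g x = 0) ->
  continuous_at x (fun y => g y * ramp (a y) (m y)).
Proof.
move=> gc ac mc a1 ga; apply: continuous_at_mul_bounded => // [y|gx].
  exact: ramp_norm.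
have ax : a x - 1 != 0.
  by rewrite subr_eq0; apply/eqP => /ga g0; rewrite g0 eqxx in gx.
rewrite /ramp; apply: continuous_at_min; first exact: continuous_at_cst.
apply: continuous_at_mul; first by cont.
by apply: continuous_at_inv => //; cont.
Qed.

Section Twist.
Variables (g rho : R -> R).
Hypothesis gc : continuous g.
Hypothesis rhoc : continuous rho.
Hypothesis rho1 : forall z, 1 <= rho z.
Hypothesis g0 : forall z, rho z = 1 -> g z = 0.

Definition axis_dist v : R := Num.sqrt (X_ v ^+ 2 + Y_ v ^+ 2).
Definition twist_angle v : R := g (Z_ v) * ramp (rho (Z_ v)) (axis_dist v).
Definition turn (a : R) v : 'rV[R]_3 :=
  point3 (cos a * X_ v - sin a * Y_ v) (sin a * X_ v + cos a * Y_ v) (Z_ v).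
Definition twist (t : R) v : 'rV[R]_3 := turn (t * twist_angle v) v.

Lemma turn_axis_dist a v : axis_dist (turn a v) = axis_dist v.
Proof.
rewrite /axis_dist /turn !point3E; congr Num.sqrt.
transitivity ((cos a ^+ 2 + sin a ^+ 2) * (X_ v ^+ 2 + Y_ v ^+ 2)); first by ring.
by rewrite cos2Dsin2 mul1r.
Qed.

Lemma turnK a : cancel (turn a) (turn (- a)).
Proof.
move=> v; rewrite /turn !point3E cosN sinN -[RHS]point3K; congr point3.
  transitivity ((cos a ^+ 2 + sin a ^+ 2) * X_ v); first by ring.
  by rewrite cos2Dsin2 mul1r.
transitivity ((cos a ^+ 2 + sin a ^+ 2) * Y_ v); first by ring.
by rewrite cos2Dsin2 mul1r.
Qed.

(** Turning a horizontal plane keeps the distance to the axis, on which the angle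
    depends, so the turn by the opposite angle is the inverse. *)
Lemma twistK t : cancel (twist t) (twist (- t)).
Proof.
move=> v; rewrite {1}/twist /twist_angle turn_axis_dist.
rewrite [Z_ (twist _ _)]point3E.
by rewrite mulNr -/(twist_angle v) turnK.
Qed.

Lemma twist_cont : continuous (fun p : R * 'rV[R]_3 => twist p.1 p.2).
Proof.
pose A (p : R * 'rV[R]_3) := p.1 * twist_angle p.2.
have Ac : continuous A.
  move=> p; rewrite /A; apply: continuous_at_mul; first exact: fst_cont.
  apply: continuous_at_ramp => //; try by cont.
    by rewrite /axis_dist; cont.
  exact: g0.
rewrite /twist /turn; apply: (@point3_cont _ _
  (fun p => cos (A p) * X_ p.2 - sin (A p) * Y_ p.2)
  (fun p => sin (A p) * X_ p.2 + cos (A p) * Y_ p.2)) => p; cont.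
Qed.

Lemma twist_fixes t : fixes_rails (twist t).
Proof.
move=> v X1 Y0; rewrite /twist /twist_angle ramp_in ?mulr0.
  by rewrite /turn !point3E cos0 sin0 !mul1r !mul0r subr0 add0r.
by rewrite /axis_dist X1 Y0 expr0n /= addr0 sqrtr1.
Qed.

Lemma twist_motion : rail_motion twist.
Proof.
apply: rail_motion_intro; first exact: twist_cont.
  by move=> v; rewrite /twist mul0r /turn cos0 sin0 !mul1r !mul0r subr0 add0r point3K.
move=> t _; split; first exact: twist_fixes.
exists (twist (- t)); split.
- move=> v; apply: (@continuous_at_of _ _ _ (fun p : R * 'rV[R]_3 => twist p.1 p.2)
    (fun v => (- t, v))); first exact: twist_cont.
  by apply: continuous_at_pair; [exact: continuous_at_cst|exact: cvg_id].
- exact: twistK.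
- by move=> v; have := twistK (- t) v; rewrite opprK.
- exact: twist_fixes.
Qed.

End Twist.

Section Stretch.
Variable kappa : R.

(** For large [kappa] the unit ball is a thin rhombus with the punctures as acute
    corners; unlike a disc it leaves room for a segment that starts at a puncture
    and turns by nearly pi about the origin. *)
Definition gauge (x y : R) : R := `|x| + kappa * `|y|.

Lemma gaugeZ m x y : 0 <= m -> gauge (m * x) (m * y) = m * gauge x y.
Proof. by move=> m0; rewrite /gauge !normrM (ger0_norm m0); ring. Qed.

Definition scaling (a b m : R) : R := 1 + (b - a) * ramp a m / Num.max m 1.

Lemma scaling_in a b m : m <= 1 -> scaling a b m = 1.
Proof. by move=> m1; rewrite /scaling ramp_in // mulr0 mul0r addr0. Qed.

Lemma scaling_same a m : scaling a a m = 1.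
Proof. by rewrite /scaling subrr !mul0r addr0. Qed.

(** For [a > 1] the map [m |-> m * scaling a b m] is affine from [[1, a]] to
    [[1, b]] and a translation beyond. *)
Lemma scalingE a b m : 1 < a -> 1 < m -> m * scaling a b m =
  if a <= m then m + b - a else 1 + (m - 1) * (b - 1) / (a - 1).
Proof.
move=> a1 m1; have m0 : 0 < m by rewrite (lt_trans _ m1).
have a0 : 0 < a - 1 by rewrite subr_gt0.
rewrite /scaling (max_idPl (ltW m1)) mulrDr mulr1 mulrC divfK ?gt_eqF //.
have [am|ma] := leP a m; first by rewrite ramp_out // mulr1 addrA.
by rewrite ramp_mid ?ltW //; field; rewrite gt_eqF.
Qed.

Lemma scaling_inv a b m : 1 <= a -> 1 <= b -> (a = 1 <-> b = 1) ->
  0 < scaling a b m /\ scaling b a (m * scaling a b m) * scaling a b m = 1.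
Proof.
move=> a1 b1 ab.
have [->|anb] := eqVneq a b; first by rewrite !scaling_same mulr1 ltr01.
have an1 : a != 1.
  by apply/eqP => a1'; move/eqP: anb; apply; rewrite a1'; apply/esym/ab.
have bn1 : b != 1 by apply/eqP => b1'; move/eqP: an1; apply; apply/ab.
have {}a1 : 1 < a by rewrite lt_neqAle eq_sym an1.
have {}b1 : 1 < b by rewrite lt_neqAle eq_sym bn1.
have [m1|m1] := leP m 1; first by rewrite scaling_in // mulr1 scaling_in // mulr1.
have m0 : 0 < m by rewrite (lt_trans _ m1).
set f := m * scaling a b m.
have fE : f = if a <= m then m + b - a else 1 + (m - 1) * (b - 1) / (a - 1).
  exact: scalingE.
have a0 : 0 < a - 1 by rewrite subr_gt0.
have b0 : 0 < b - 1 by rewrite subr_gt0.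
have q0 : 0 < (m - 1) * (b - 1) / (a - 1) by rewrite divr_gt0 ?mulr_gt0 // subr_gt0.
have f1 : 1 < f.
  by rewrite fE; case: (leP a m) => ?; [lra | rewrite ltrDl].
have back : f * scaling b a f = m.
  rewrite scalingE //; case: (leP a m) fE => [am|ma] fE.
    have bf : b <= f by lra.
    by rewrite bf fE; ring.
  have fb : f < b.
    rewrite fE -ltrBrDl mulrAC gtr_pMl // ltr_pdivrMr // mul1r ltrD2r //.
  by rewrite leNgt fb /= fE; field; rewrite !gt_eqF.
have f0 : 0 < f by rewrite (lt_trans _ f1).
have s0 : 0 < scaling a b m by move: f0; rewrite /f pmulr_rgt0.
split=> //; apply: (mulfI (lt0r_neq0 m0)).
by rewrite mulr1 mulrC -mulrA (mulrC _ m) -/f mulrC back.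
Qed.

Definition stretch (a b : R -> R) v : 'rV[R]_3 :=
  let m := scaling (a (Z_ v)) (b (Z_ v)) (gauge (X_ v) (Y_ v)) in
  point3 (m * X_ v) (m * Y_ v) (Z_ v).

Lemma stretchK (a b : R -> R) : (forall z, 1 <= a z) -> (forall z, 1 <= b z) ->
  (forall z, a z = 1 <-> b z = 1) -> cancel (stretch a b) (stretch b a).
Proof.
move=> a1 b1 ab v; rewrite /stretch !point3E.
have [s0 sK] := scaling_inv (gauge (X_ v) (Y_ v)) (a1 (Z_ v)) (b1 (Z_ v)) (ab (Z_ v)).
rewrite gaugeZ ?(ltW s0) // (mulrC (scaling _ _ _) (gauge _ _)) !mulrA.
by rewrite sK !mul1r point3K.
Qed.

Lemma stretch_fixes a b : fixes_rails (stretch a b).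
Proof.
move=> v X1 Y0; rewrite /stretch !point3E scaling_in ?mul1r //.
rewrite /gauge Y0 normr0 mulr0 addr0.
have /eqP := X1; rewrite sqrf_eq1 => /orP[] /eqP ->; by rewrite ?normrN normr1.
Qed.

(** Joint continuity in the vector and in a parameter on which the two target
    gauge values depend. *)
Lemma stretch_cont (T : topologicalType) (V : T -> 'rV[R]_3) (a b : T -> R -> R) :
  continuous V ->
  continuous (fun x => a x (Z_ (V x))) -> continuous (fun x => b x (Z_ (V x))) ->
  (forall x z, 1 <= a x z) -> (forall x z, a x z = 1 -> b x z = 1) ->
  continuous (fun x => stretch (a x) (b x) (V x)).
Proof.
move=> Vc ac bc a1 ab.
have Nc : continuous (fun x => gauge (X_ (V x)) (Y_ (V x))).
  by move=> x; rewrite /gauge; cont.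
have sc : continuous (fun x => scaling (a x (Z_ (V x))) (b x (Z_ (V x)))
    (gauge (X_ (V x)) (Y_ (V x)))).
  move=> x; rewrite /scaling; apply: continuous_at_add; first exact: continuous_at_cst.
  apply: continuous_at_mul.
    apply: continuous_at_ramp => //.
    - by apply: continuous_at_add; [exact: bc|apply: continuous_at_opp; exact: ac].
    - by move=> ax; rewrite ax (ab _ _ ax) subrr.
  apply: continuous_at_inv.
    by rewrite gt_eqF // lt_max ltr01 orbT.
  by apply: continuous_at_max; [exact: Nc|exact: continuous_at_cst].
rewrite /stretch; apply: point3_cont => //.
- by move=> x; apply: continuous_at_mul; [exact: sc|cont].
- by move=> x; apply: continuous_at_mul; [exact: sc|cont].
- by move=> x; cont.
Qed.

Lemma stretch_motion (a b : R -> R) : continuous a -> continuous b ->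
  (forall z, 1 <= a z) -> (forall z, 1 <= b z) -> (forall z, a z = 1 <-> b z = 1) ->
  rail_motion (fun t => stretch a (fun z => a z + t * (b z - a z))).
Proof.
move=> ac bc a1 b1 ab.
apply: rail_motion_intro.
- apply: (@stretch_cont (R * 'rV[R]_3)%type (fun p => p.2)
    (fun _ => a) (fun p z => a z + p.1 * (b z - a z))).
  + exact: snd_cont.
  + by move=> p; cont.
  + by move=> p; cont.
  + by [].
  + by move=> p z az; rewrite az ((ab z).1 az); ring.
- move=> v; rewrite /stretch (_ : scaling _ _ _ = 1) ?mul1r ?point3K //.
  by rewrite mul0r addr0 scaling_same.
move=> t /andP[t0 t1]; pose c z := a z + t * (b z - a z).
have c1 z : 1 <= c z by rewrite /c; have := a1 z; have := b1 z; nra.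
have cc : continuous c by move=> z; rewrite /c; cont.
have ac' z : a z = 1 <-> c z = 1.
  split=> [az|cz]; first by rewrite /c az ((ab z).1 az); ring.
  have az := a1 z; have bz := b1 z; apply/le_anti; rewrite az andbT.
  have [t1'|t1'] := eqVneq t 1.
    have : b z = 1 by rewrite -cz /c t1'; ring.
    by move/(ab z).2 => ->.
  have t1lt : t < 1 by rewrite lt_neqAle t1'.
  by move: cz; rewrite /c => cz; nra.
split; first exact: stretch_fixes.
exists (stretch c a); split.
- apply: (@stretch_cont _ id (fun _ => c) (fun _ => a)) => //.
  + by move=> v; exact: cvg_id.
  + by move=> v; cont.
  + by move=> v; cont.
  + by move=> _ z; exact: (ac' z).2.
- exact: stretchK.
- by apply: stretchK => // z; split=> /ac'.
- exact: stretch_fixes.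
Qed.

End Stretch.

(** Straight-line interpolation works for the heights, since a convex combination
    of increasing homeomorphisms of the line is one again. *)
Lemma lift_motion (g : R -> R) : continuous g -> (forall a b : R, a < b -> g a < g b) ->
  (forall y, exists x, g x <= y) -> (forall y, exists x, y <= g x) ->
  rail_motion (fun t v => point3 (X_ v) (Y_ v) (Z_ v + t * (g (Z_ v) - Z_ v))).
Proof.
move=> gc ginc glo ghi.
have gle a b : a <= b -> g a <= g b.
  by rewrite le_eqVlt => /orP[/eqP -> //|/ginc /ltW].
apply: rail_motion_intro.
- by apply: point3_cont => p; cont.
- by move=> v; rewrite mul0r addr0 point3K.
move=> t /andP[t0 t1]; split; first by move=> v _ _; rewrite !point3E.
pose f z := z + t * (g z - z).
have [||y|y|k [kc fK kK]] := @increasing_inverse R f.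
- by move=> z; rewrite /f; cont.
- move=> a b ab; have gab := ginc _ _ ab; rewrite /f.
  have [t1'|t1'] := eqVneq t 1; first by rewrite t1'; lra.
  have t1lt : t < 1 by rewrite lt_neqAle t1' t1.
  by nra.
- have [x gx] := glo y; exists (Num.min x y).
  have m1 : Num.min x y <= y by rewrite ge_min lexx orbT.
  have m2 : g (Num.min x y) <= y.
    by apply: le_trans gx; apply: gle; rewrite ge_min lexx.
  by rewrite /f; nra.
- have [x gx] := ghi y; exists (Num.max x y).
  have m1 : y <= Num.max x y by rewrite le_max lexx orbT.
  have m2 : y <= g (Num.max x y).
    by apply: le_trans gx _; apply: gle; rewrite le_max lexx.
  by rewrite /f; nra.
exists (fun v => point3 (X_ v) (Y_ v) (k (Z_ v))); split.
- by apply: point3_cont => v; cont; exact: cvg_id.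
- by move=> v; rewrite !point3E -/(f (Z_ v)) fK point3K.
- by move=> v; rewrite !point3E -/(f (k (Z_ v))) kK point3K.
- by move=> v _ _; rewrite !point3E.
Qed.

End Motions.

(** * The polygon *)

Section Interpolation.
Context {R : realType}.

(** The function with value [c k] at [k <= M] and affine in between. *)
Definition interp (c : nat -> R) (M : nat) (a : R) : R :=
  c 0%N + \sum_(i < M) clamp 0 1 (a - i%:R) * (c i.+1 - c i).

Lemma interp_cont c M : continuous (interp c M).
Proof.
move=> a; apply: continuous_at_add; first exact: continuous_at_cst.
by apply: continuous_at_sum => i; cont.
Qed.

Lemma interpS c M a :
  interp c M.+1 a = interp c M a + clamp 0 1 (a - M%:R) * (c M.+1 - c M).
Proof. by rewrite /interp big_ord_recr /= addrA. Qed.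

Lemma interp_end c M a : M%:R <= a -> interp c M a = c M.
Proof.
elim: M => [|M IH] aM; first by rewrite /interp big_ord0 addr0.
rewrite -natr1 in aM.
by rewrite interpS IH ?clamp_hi //; [ring|lra|lra].
Qed.

Lemma interpE c M k l : (k < M)%N -> 0 <= l <= 1 ->
  interp c M (k%:R + l) = (1 - l) * c k + l * c k.+1.
Proof.
move=> kM l01; elim: M kM => [//|M IH]; rewrite ltnS leq_eqVlt => /orP[/eqP ->|kM].
  rewrite interpS interp_end; last by lra.
  rewrite (_ : M%:R + l - M%:R = l); last by ring.
  by rewrite clamp_id //; ring.
rewrite interpS IH // clamp_lo ?mul0r ?addr0 //.
have : k.+1%:R <= M%:R :> R by rewrite ler_nat.
by rewrite -natr1; lra.
Qed.

Lemma nat_split (M : nat) (a : R) : (0 < M)%N -> 0 <= a <= M%:R ->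
  exists k : nat, exists2 l : R, (k < M)%N & 0 <= l <= 1 /\ a = k%:R + l.
Proof.
elim: M a => [//|[|M] IH] a _ /andP[a0 aM].
  by exists 0%N, a => //; rewrite a0 add0r.
have [aS|aS] := leP a M.+1%:R.
  have [||k [l kM lE]] := IH a; rewrite ?a0 //.
  by exists k, l => //; exact: ltnW.
exists M.+1, (a - M.+1%:R) => //; split; last by rewrite addrC subrK.
by move: aM; rewrite -[M.+2%:R]natr1; lra.
Qed.

End Interpolation.

Section Polygon.
Context {R : realType}.
Variable N : nat.

Definition edge_count : nat := 2 * N + 2.
Notation M := edge_count.
Definition total_angle : R := (2 * N + 1)%:R * pi.
Definition step : R := total_angle / M%:R.
(** Edges between two corners at this distance come no closer than 2 to the
    origin. *)
Definition far : R := 2 / cos (step / 2).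
Definition corner_radius (k : nat) : R :=
  if (k == 0%N) || (k == M) then 1 else far.
Definition corner_x (k : nat) : R := corner_radius k * cos (k%:R * step).
Definition corner_y (k : nat) : R := corner_radius k * sin (k%:R * step).
Definition poly_x : R -> R := interp corner_x M.
Definition poly_y : R -> R := interp corner_y M.
(** With this weight on the second coordinate the first edge leaves the unit
    rhombus, although it turns by almost pi about the origin. *)
Definition slope : R := 1 + 2 / sin step.

Lemma edge_count_gt0 : (0 < M)%N. Proof. by rewrite /edge_count addn2. Qed.

Lemma step_total : M%:R * step = total_angle.
Proof. by rewrite /step mulrC divfK // pnatr_eq0 -lt0n edge_count_gt0. Qed.

Lemma step_gt0 : 0 < step.
Proof.
by rewrite /step divr_gt0 ?mulr_gt0 ?pi_pos ?ltr0n ?edge_count_gt0 // addn1.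
Qed.

Lemma step_ltpi : step < pi.
Proof.
rewrite /step ltr_pdivrMr ?ltr0n ?edge_count_gt0 // /total_angle mulrC ltr_pM2l ?pi_pos //.
by rewrite ltr_nat /edge_count addn2 addn1.
Qed.

Lemma cos_half_gt0 : 0 < cos (step / 2).
Proof.
have := step_gt0; have := step_ltpi; have := pi_pos (R := R) => p0 s1 s0.
by apply: cos_gt0_pihalf; apply/andP; split; lra.
Qed.

Lemma sin_step_gt0 : 0 < sin step.
Proof. by apply: sin_gt0_pi; rewrite step_gt0 step_ltpi. Qed.

Lemma far_cos : far * cos (step / 2) = 2.
Proof. by rewrite /far divfK // gt_eqF // cos_half_gt0. Qed.

Lemma far_ge2 : 2 <= far.
Proof.
by rewrite -{1}far_cos ler_piMr ?cos_le1 // divr_ge0 // ltW // cos_half_gt0.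
Qed.

Lemma slope_ge1 : 1 <= slope.
Proof. by rewrite /slope lerDl divr_ge0 // ltW // sin_step_gt0. Qed.

Lemma corner_radius_gt0 k : 0 < corner_radius k.
Proof.
rewrite /corner_radius; case: ifP => _ //.
exact: lt_le_trans far_ge2.
Qed.

(** The component along the direction half way between the two corners bounds the
    distance of the edge from the origin from below. *)
Lemma edge_middle k l (mid := k%:R * step + step / 2) : (k < M)%N -> 0 <= l <= 1 ->
  poly_x (k%:R + l) * cos mid + poly_y (k%:R + l) * sin mid
  = ((1 - l) * corner_radius k + l * corner_radius k.+1) * cos (step / 2).
Proof.
move=> kM l01; rewrite /poly_x /poly_y !interpE // /corner_x /corner_y.
have c1 : cos (k%:R * step) * cos mid + sin (k%:R * step) * sin mid = cos (step / 2).
  by rewrite -cosB /mid opprD addNKr cosN.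
have c2 : cos (k.+1%:R * step) * cos mid + sin (k.+1%:R * step) * sin mid = cos (step / 2).
  by rewrite -cosB /mid -natr1; congr cos; lra.
transitivity ((1 - l) * corner_radius k * cos (step / 2)
  + l * corner_radius k.+1 * cos (step / 2)); last by ring.
by rewrite -{1}c1 -c2; ring.
Qed.

Lemma edge_middle_gt0 k l : 0 <= l <= 1 ->
  0 < ((1 - l) * corner_radius k + l * corner_radius k.+1) * cos (step / 2).
Proof.
move=> l01; rewrite mulr_gt0 ?cos_half_gt0 //.
have := corner_radius_gt0 k; have := corner_radius_gt0 k.+1.
have [->|ln] := eqVneq l 0; first lra.
have : 0 < l by move: l01; rewrite lt_neqAle eq_sym ln => /andP[].
by nra.
Qed.

Lemma sin_eq0_small (y : R) : `|y| < pi / 2 -> sin y = 0 -> y = 0.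
Proof.
rewrite ltr_norml => /andP[y1 y2] s0; have p0 := pi_pos (R := R).
by apply: sin_inj; rewrite ?in_itv /= ?sin0 //; lra.
Qed.

(** The angle exists by lifting.  On an edge it stays within a right angle of the
    direction half way between the corners, so it grows by exactly [step], not
    by [step] plus full turns. *)
Lemma poly_angle : exists2 th : R -> R, continuous th &
  [/\ th 0 = 0, th M%:R = total_angle &
  forall a : R, 0 <= a <= M%:R -> angle_of (poly_x a) (poly_y a) (th a)].
Proof.
have p0 := pi_pos (R := R).
have s0 := step_gt0; have s1 := step_ltpi.
have M0 : 0 <= M%:R :> R by rewrite ler0n.
have Xc : continuous (fun p : R * R => poly_x p.2).
  by move=> p; apply: (continuous_at_of (@interp_cont R corner_x M)); exact: snd_cont.
have Yc : continuous (fun p : R * R => poly_y p.2).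
  by move=> p; apply: (continuous_at_of (@interp_cont R corner_y M)); exact: snd_cont.
have [|th thc thE] := angle_lift ler01 M0 Xc Yc.
  move=> p /rectP [_ /(nat_split edge_count_gt0) [k [l kM [l01 ->]]]] [x0 y0].
  have := edge_middle_gt0 k l01; rewrite -edge_middle // x0 y0 !mul0r addr0.
  by rewrite ltxx.
have {}thE a : 0 <= a <= M%:R -> angle_of (poly_x a) (poly_y a) (th (0, a)).
  by move=> aM; apply: (thE (0, a)); apply/rectP; rewrite /= lexx ler01.
have th1c : continuous (fun a => th (0, a)) by move=> a; cont.
have at_corner k : (k <= M)%N ->
    poly_x k%:R = corner_x k /\ poly_y k%:R = corner_y k.
  rewrite leq_eqVlt => /orP[/eqP ->|kM].
    by rewrite /poly_x /poly_y !interp_end.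
  rewrite -[k%:R]addr0 /poly_x /poly_y !interpE ?lexx ?ler01 //.
  by rewrite subr0 !mul1r !mul0r !addr0.
(* at a corner the angle is right up to full turns *)
have corner_mod k y : (k <= M)%N -> th (0, k%:R) = k%:R * step + y ->
    0 < cos y /\ sin y = 0.
  move=> kM thk.
  have [|rho rho0] := thE k%:R; first by rewrite ler0n ler_nat.
  have [-> ->] := at_corner k kM; rewrite /corner_x /corner_y thk => -[E1 E2].
  have r0 := corner_radius_gt0 k.
  have C : rho * cos y = corner_radius k.
    transitivity (rho * cos (k%:R * step + y) * cos (k%:R * step)
      + rho * sin (k%:R * step + y) * sin (k%:R * step)).
      rewrite -!mulrA -mulrDr -cosB; congr (_ * cos _); ring.
    rewrite -E1 -E2 -!mulrA -mulrDr -!expr2 cos2Dsin2 mulr1 //.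
  have D : rho * sin y = 0.
    transitivity (rho * sin (k%:R * step + y) * cos (k%:R * step)
      - rho * cos (k%:R * step + y) * sin (k%:R * step)).
      rewrite -!mulrA -mulrBr -sinB; congr (_ * sin _); ring.
    by rewrite -E1 -E2; ring.
  split; first by rewrite -(pmulr_rgt0 _ rho0) C.
  by apply/eqP; move/eqP: D; rewrite mulf_eq0 gt_eqF.
have [c0 d0] := corner_mod 0%N (th (0, 0)) (leq0n _) ltac:(by rewrite mul0r add0r).
have [j Hj] := cos_gt0_near c0.
set sh := j%:~R * (pi *+ 2) in Hj.
have th0 : th (0, 0) - sh = 0 by apply: sin_eq0_small => //; rewrite sin_int2pi.
pose th' a := th (0, a) - sh.
have th'k k : (k <= M)%N -> th' k%:R = k%:R * step.
  elim: k => [|k IH] kM; first by rewrite mul0r /th' th0.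
  have {}IH := IH (ltnW kM).
  have kS : k%:R <= k.+1%:R :> R by rewrite ler_nat.
  have kS' : k.+1%:R = k%:R + 1 :> R by rewrite natr1.
  pose mid := k%:R * step + step / 2.
  have tr : `|th' k.+1%:R - mid| < pi / 2.
    apply: (@angle_trap _ (fun a => th' a - mid) k%:R) => //.
    - by move=> a; rewrite /th'; cont; exact: th1c.
    - move=> a /andP[ka ak].
      have lE : a = k%:R + (a - k%:R) by ring.
      have l01 : 0 <= a - k%:R <= 1 by lra.
      have [|rho rho0 [E1 E2]] := thE a.
        rewrite (le_trans _ ka) ?ler0n //= (le_trans ak) // ler_nat //.
      have := edge_middle_gt0 k l01; rewrite -edge_middle // -lE -/mid E1 E2.
      rewrite -!mulrA -mulrDr -cosB pmulr_rgt0 //.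
      by rewrite /th' addrAC cos_int2pi.
    - by rewrite IH /mid opprD addNKr normrN gtr0_norm; lra.
  set y := th' k.+1%:R - k.+1%:R * step.
  have [cy sy] : 0 < cos y /\ sin y = 0.
    have [|cy sy] := corner_mod k.+1 (y + sh) kM.
      by rewrite /y /th'; ring.
    by rewrite -(cos_int2pi _ j) -(sin_int2pi _ j) -/sh addrK in cy sy.
  have : y = 0.
    apply: sin_eq0_small => //; apply: cos_gt0_small => //.
    move: tr; rewrite /y /mid kS' ltr_norml ler_norml; lra.
  by rewrite /y => /eqP; rewrite subr_eq0 => /eqP.
exists th'; first by move=> a; rewrite /th'; cont; exact: th1c.
split; first by have := th'k 0%N (leq0n _); rewrite mul0r.
  by rewrite th'k // step_total.
move=> a aM; have [rho rho0 [E1 E2]] := thE a aM.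
by exists rho => //; rewrite /th' cos_int2pi sin_int2pi.
Qed.

Lemma gauge_ge (k x y a : R) : 1 <= k -> x * cos a + y * sin a <= gauge k x y.
Proof.
move=> k1; rewrite /gauge; apply: lerD.
  by rewrite (le_trans (ler_norm _)) // normrM ler_piMr // cos_max.
rewrite (le_trans (ler_norm _)) // normrM; apply: (@le_trans _ _ `|y|).
  by rewrite ler_piMr // sin_max.
by rewrite ler_peMl.
Qed.

Lemma gauge_ge_sum (k x y : R) : 0 <= k -> x + k * y <= gauge k x y.
Proof. by move=> k0; rewrite /gauge lerD ?ler_norm // ler_wpM2l ?ler_norm. Qed.

Lemma far_slope : 1 < far * cos step + slope * (far * sin step).
Proof.
have s0 := sin_step_gt0; have f2 := far_ge2.
have -> : far * cos step + slope * (far * sin step) = far * (cos step + sin step + 2).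
  by rewrite /slope; field; rewrite gt_eqF.
have := cos_geN1 step; nra.
Qed.

(** The inner edges are far from the origin.  On the first and last edge one
    linear function below the gauge is 1 at the puncture and larger at the other
    corner. *)
Lemma poly_gauge (a : R) : 0 < a < M%:R -> 1 < gauge slope (poly_x a) (poly_y a).
Proof.
move=> /andP[a0 aM].
have [|k [l kM [l01 aE]]] := nat_split (M := M) (a := a) edge_count_gt0.
  by rewrite !ltW.
have sl1 := slope_ge1; have f2 := far_ge2; have ch := cos_half_gt0.
have fs := far_slope.
have gg x y : x + slope * y <= gauge slope x y.
  by apply: gauge_ge_sum; exact: le_trans sl1.
have [k0|kn0] := eqVneq k 0%N.
  have l0 : 0 < l by move: a0; rewrite aE k0 add0r.
  apply: lt_le_trans (gg _ _); rewrite aE k0 /poly_x /poly_y !interpE ?edge_count_gt0 //.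
  rewrite /corner_x /corner_y /corner_radius /= !mul0r cos0 sin0 mul1r /edge_count.
  rewrite addn2 /=.
  rewrite !mul1r !mulr1 mulr0 add0r.
  by nra.
have [kl|knl] := eqVneq k.+1 M.
  have l1 : l < 1.
    by move: aM; rewrite aE -kl -natr1; lra.
  rewrite /gauge -normrN; apply: lt_le_trans (gg _ _).
  rewrite aE /poly_x /poly_y !interpE // /corner_x /corner_y kl step_total.
  have kE : k%:R * step = total_angle - step.
    by rewrite -step_total -kl -natr1; ring.
  rewrite kE /corner_radius eqxx orbT (negbTE kn0) /=.
  rewrite (_ : k == M = false); last by rewrite -kl ltn_eqF.
  have tc : cos total_angle = -1.
    rewrite /total_angle -[_ * pi]addr0 cos_natpi cos0 mulr1 addn1 exprS exprM.
    by rewrite sqrrN !expr1n mulr1.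
  have ts : sin total_angle = 0.
    by rewrite /total_angle -[_ * pi]addr0 sin_natpi sin0 mulr0.
  rewrite cosB sinB tc ts.
  by nra.
rewrite aE.
apply: lt_le_trans (gauge_ge _ _ (k%:R * step + step / 2) sl1).
rewrite edge_middle // /corner_radius (negbTE kn0) (negbTE knl) /= (ltn_eqF kM).
rewrite -mulrDl subrK mul1r far_cos.
by rewrite ltrDl.
Qed.

End Polygon.

(** * The upper bound *)

Section UpperBound.
Context {R : realType}.
Variable n : int.
Hypothesis n0 : n != 0.
Notation S := (spiral_end R n).
Notation E := (winding_end R n).
Notation N := `|n|%N.
Notation M := (edge_count N).
Notation sg := (winding_sign (R := R) n).
Notation tail := (tail_rail R).
Notation head := (head_rail R).
Notation kappa := (slope (R := R) N).
Notation px := (poly_x (R := R) N).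
Notation py := (poly_y (R := R) N).

Lemma winding_signP : sg = 1 \/ sg = -1.
Proof. by rewrite /winding_sign; move: n0; case: sgzP => // *; [left|right]. Qed.

Lemma M_gt0 : 0 < M%:R :> R. Proof. by rewrite ltr0n edge_count_gt0. Qed.

Lemma poly_start : px 0 = 1 /\ py 0 = 0.
Proof.
have z01 : 0 <= (0 : R) <= 1 by rewrite lexx ler01.
have H c : interp c M (0 : R) = c 0%N.
  have := interpE c (edge_count_gt0 N) z01.
  by rewrite addr0 subr0 mul1r mul0r addr0.
rewrite /poly_x /poly_y !H /corner_x /corner_y /corner_radius /=.
by rewrite !mul0r cos0 sin0 mulr1 mulr0.
Qed.

Lemma poly_finish : px M%:R = -1 /\ py M%:R = 0.
Proof.
rewrite /poly_x /poly_y !interp_end // /corner_x /corner_y /corner_radius eqxx orbT.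
rewrite (step_total (R := R) N) !mul1r.
by split; [exact: cos_spiral_end | exact: sin_spiral_end].
Qed.

Definition stick_arc (s : R) : 'rV[R]_3 :=
  point3 (px (M%:R * s)) (sg * py (M%:R * s)) (- (M%:R * s)).

Lemma stick_arcP : stick_rail_arc tail head M (stick_arc @` `[0, 1]).
Proof.
have M0 := M_gt0.
exists stick_arc; split=> //; last first.
  exists (fun i => i%:R / M%:R); split.
  - by rewrite mul0r.
  - by rewrite divff // gt_eqF.
  - by move=> i iM; rewrite ltr_pM2r ?invr_gt0 // ltr_nat.
  - move=> i iM s s01; rewrite /stick_arc.
    have e0 : M%:R * (i%:R / M%:R) = i%:R + 0 :> R.
      by rewrite addr0 mulrC divfK // gt_eqF.
    have e1 : M%:R * (i.+1%:R / M%:R) = i%:R + 1 :> R.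
      by rewrite natr1 mulrC divfK // gt_eqF.
    have es : M%:R * ((1 - s) * (i%:R / M%:R) + s * (i.+1%:R / M%:R)) = i%:R + s :> R.
      transitivity ((1 - s) * (M%:R * (i%:R / M%:R)) + s * (M%:R * (i.+1%:R / M%:R))).
        by ring.
      by rewrite e0 e1; ring.
    rewrite es e0 e1 /poly_x /poly_y !interpE ?lexx ?ler01 //.
    by apply/rowP => j; rewrite !mxE; case: j => -[|[|[|//]]] ? /=; ring.
split.
- apply: continuous_subspaceT; rewrite /stick_arc.
  have pxc : continuous px by exact: interp_cont.
  have pyc : continuous py by exact: interp_cont.
  by apply: point3_cont => s; cont.
- move=> s s' _ _ /(congr1 (fun v : 'rV[R]_3 => Z_ v)); rewrite !Z_point3.
  by move/oppr_inj/(mulfI (lt0r_neq0 M0)).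
- apply/vertical_lineE; rewrite X_point3 Y_point3 mulr0.
  by have [-> ->] := poly_start; rewrite mulr0.
- apply/vertical_lineE; rewrite X_point3 Y_point3 mulr1.
  by have [-> ->] := poly_finish; rewrite mulr0.
- move=> s /andP[s0 s1].
  have g1 : 1 < gauge kappa (px (M%:R * s)) (py (M%:R * s)).
    by apply: poly_gauge; rewrite mulr_gt0 //= gtr_pMr.
  have H (c : R) : `|c| = 1 -> ~ vertical_line c 0 (stick_arc s).
    move=> c1 /vertical_lineE; rewrite X_point3 Y_point3 => -[xE yE].
    have {}yE : py (M%:R * s) = 0.
      by move/eqP: yE; have [->|->] := winding_signP; rewrite ?mul1r ?mulN1r ?oppr_eq0 => /eqP.
    by move: g1; rewrite /gauge xE yE c1 normr0 mulr0 addr0 ltxx.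
  by case; apply: H; rewrite ?normrN normr1.
Qed.

(** At each height the arc and the polygon have one point each.  The parameter [u]
    of the arc and the parameter [c * u] of the polygon both run through their
    whole range, and the three motions carry one point to the other. *)
Theorem winding_sticks_le (W : set 'rV[R]_3) :
  winding_rail_arc n W -> stick_presentable tail head W M.
Proof.
move=> [h [hc hdec WE]].
have E0 := winding_end_gt0 (R := R) n.
have M0 := M_gt0.
have [hx [eta [hxc etac hxK etaK [hxE hxdec]]]] := height_extension E0 hc hdec.
have [th thc [th0 thM thP]] := poly_angle (R := R) N.
pose c : R := M%:R / E.
have c0 : 0 < c by rewrite divr_gt0.
pose u z := clamp 0 E (eta z).
have uc : continuous u by move=> z; rewrite /u; cont.
have uE z : 0 <= u z <= E by apply: clamp_itv; exact: ltW.
have cuM (v : R) : 0 <= v <= E -> 0 <= c * v <= M%:R.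
  move=> /andP[v0 vE]; rewrite mulr_ge0 ?(ltW c0) //=.
  by rewrite /c mulrAC ler_pdivrMr // ler_pM2l.
have cE : c * E = M%:R by rewrite /c divfK // gt_eqF.
have uh (v : R) : 0 <= v <= E -> u (h v) = v.
  by move=> vE; rewrite /u -hxE // hxK clamp_id.
have inner (v : R) : 0 <= v <= E -> [\/ v = 0, v = E | 0 < v < E].
  move=> /andP[v0 vE]; move: v0; rewrite le_eqVlt => /orP[/eqP <-|v0].
    by constructor 1.
  move: vE; rewrite le_eqVlt => /orP[/eqP ->|vE]; first by constructor 2.
  by constructor 3; rewrite v0.
have ss : sg * sg = 1 by exact: winding_sign_sqr.
pose rad z := winding_radius n (u z).
have radc : continuous rad.
  by move=> z; rewrite /rad /winding_radius; cont.
pose ang z := winding_angle n (u z).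
have angc : continuous ang by move=> z; rewrite /ang /winding_angle; cont.
pose al z := th (c * u z).
have alc : continuous al by move=> z; rewrite /al; cont.
have rad1 z : 1 <= rad z by exact: winding_radius_ge1.
pose g z := sg * (al z - ang z).
have gc : continuous g by move=> z; rewrite /g; cont.
have g0 z : rad z = 1 -> g z = 0.
  have [uz|uz|uz] := inner _ (uE z).
  - by rewrite /g /al /ang uz mulr0 th0 winding_angle0 subrr mulr0.
  - by rewrite /g /al /ang uz cE thM winding_angleE subrr mulr0.
  - by move=> r1; have := winding_radius_gt1 uz; rewrite -/(rad z) r1 ltxx.
have F1 := twist_motion gc radc rad1 g0.
pose ga z := gauge kappa (rad z * cos (al z)) (rad z * sin (al z)).
pose gb z := gauge kappa (px (c * u z)) (py (c * u z)).
have pxc : continuous px by exact: interp_cont.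
have pyc : continuous py by exact: interp_cont.
have gac : continuous ga by move=> z; rewrite /ga /gauge; cont.
have gbc : continuous gb by move=> z; rewrite /gb /gauge; cont.
have gends z : u z = 0 \/ u z = E -> ga z = 1 /\ gb z = 1.
  case=> uz; rewrite /ga /gb /al /rad uz.
    rewrite mulr0 th0 winding_radius0 cos0 sin0; have [-> ->] := poly_start.
    by rewrite /gauge !mul1r normr1 normr0 mulr0 addr0.
  rewrite cE thM winding_radiusE.
  have [-> ->] := poly_finish.
  rewrite -[total_angle N]/S cos_spiral_end sin_spiral_end.
  by rewrite /gauge !mul1r normrN normr1 normr0 mulr0 addr0.
have gin z : 0 < u z < E -> 1 < ga z /\ 1 < gb z.
  move=> uz; split.
    apply: lt_le_trans (winding_radius_gt1 uz) _.
    apply: le_trans (gauge_ge _ _ (al z) (slope_ge1 (R := R) N)).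
    by rewrite -!mulrA -mulrDr -!expr2 cos2Dsin2 mulr1.
  apply: poly_gauge.
  move: uz => /andP[uz1 uz2]; rewrite mulr_gt0 //=.
  by rewrite -cE ltr_pM2l.
have gcase z : (ga z = 1 /\ gb z = 1) \/ (1 < ga z /\ 1 < gb z).
  have [uz|uz|uz] := inner _ (uE z); [left|left|right].
  - by apply: gends; left.
  - by apply: gends; right.
  - exact: gin.
have ga1 z : 1 <= ga z by have [[-> _]|[/ltW]] := gcase z.
have gb1 z : 1 <= gb z by have [[_ ->]|[_ /ltW]] := gcase z.
have gab z : ga z = 1 <-> gb z = 1.
  have [[-> ->]|[g1 g2]] := gcase z; first by [].
  by split=> gz; [move: g1|move: g2]; rewrite gz ltxx.
have F2 := stretch_motion kappa gac gbc ga1 gb1 gab.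
pose k z := - (c * eta z).
have kc : continuous k by move=> z; rewrite /k; cont.
have kinc (a b : R) : a < b -> k a < k b.
  move=> ab; rewrite /k ltrN2 ltr_pM2l // ltNge; apply/negP => eab.
  have : hx (eta b) <= hx (eta a).
    by move: eab; rewrite le_eqVlt => /orP[/eqP ->|/hxdec /ltW].
  by rewrite !etaK leNgt ab.
have ksurj y : k (hx (- (y / c))) = y.
  by rewrite /k hxK mulrN opprK mulrC divfK // gt_eqF.
have klo y : exists x, k x <= y by exists (hx (- (y / c))); rewrite ksurj.
have khi y : exists x, y <= k x by exists (hx (- (y / c))); rewrite ksurj.
have F3 := lift_motion kc kinc klo khi.
have F := rail_motion_comp (rail_motion_comp F1 F2) F3.
exists (stick_arc @` `[0, 1]); first exact: stick_arcP.
have FW := rail_motion_isotopic W F.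
set f := fun t v => _ in F FW.
have image (v : R) : 0 <= v <= E ->
    f 1 (point3 (winding_x n v) (winding_y n v) (h v)) = stick_arc (v / E).
  move=> vE; have /andP[v0 vE'] := vE.
  have uhv := uh v vE.
  have radh : rad (h v) = winding_radius n v by rewrite /rad uhv.
  have alh : al (h v) = th (c * v) by rewrite /al uhv.
  set r := winding_radius n v in radh; set a := th (c * v) in alh.
  have r1 : 1 <= r by exact: winding_radius_ge1.
  have twisted : twist g rad 1 (point3 (winding_x n v) (winding_y n v) (h v))
      = point3 (r * cos a) (sg * (r * sin a)) (h v).
    have radiusE : axis_dist (point3 (winding_x n v) (winding_y n v) (h v)) = r.
      rewrite /axis_dist !point3E winding_circle // sqrtr_sqr ger0_norm //.
      exact: le_trans r1.
    rewrite /twist /twist_angle radiusE !point3E mul1r radh.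
    have -> : g (h v) * ramp r r = sg * (a - winding_angle n v).
      have <- : g (h v) = sg * (a - winding_angle n v) by rewrite /g /ang uhv alh.
      have [r1'|rn1] := eqVneq r 1; first by rewrite (g0 (h v)) ?mul0r // radh.
      by rewrite ramp_out ?mulr1 // lt_neqAle eq_sym rn1.
    rewrite /turn !point3E; have [-> ->] := winding_polar vE'.
    rewrite -/r; set b := winding_angle n v.
    have [ca sa] : cos (sg * (a - b)) = cos (a - b) /\
        sin (sg * (a - b)) = sg * sin (a - b).
      by have [->|->] := winding_signP; rewrite ?mul1r // !mulN1r cosN sinN.
    have aE : a = (a - b) + b by rewrite subrK.
    rewrite ca sa; congr point3; rewrite [in RHS]aE ?(cosD (a - b) b) ?(sinD (a - b) b).
      transitivity (r * (cos (a - b) * cos b) - (sg * sg) * (r * (sin (a - b) * sin b))).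
        by ring.
      by rewrite ss; ring.
    by ring.
  have stretched : stretch kappa ga (fun z => ga z + 1 * (gb z - ga z))
      (point3 (r * cos a) (sg * (r * sin a)) (h v))
      = point3 (px (c * v)) (sg * py (c * v)) (h v).
    rewrite /stretch !point3E mul1r [ga (h v) + _]addrC subrK.
    have -> : gauge kappa (r * cos a) (sg * (r * sin a)) = ga (h v).
      rewrite /ga radh alh /gauge [`|sg * _|]normrM.
      have -> : `|sg| = 1 by have [->|->] := winding_signP; rewrite ?normrN normr1.
      by rewrite mul1r.
    have [rho rho0 [xE yE]] := thP _ (cuM v vE).
    have [[A1 B1]|[A1 B1]] := gcase (h v).
      have vends : v = 0 \/ v = E.
        have [|//|vin] := inner v vE; [by left|by right|].
        by have := gin (h v); rewrite uhv A1 ltxx => /(_ vin) [].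
      rewrite scaling_in ?A1 // !mul1r; case: vends => vv.
        rewrite /a /r vv mulr0 th0 winding_radius0 cos0 sin0.
        by have [-> ->] := poly_start; rewrite !mul1r.
      rewrite /a /r vv cE thM winding_radiusE.
      have [-> ->] := poly_finish.
      by rewrite -[total_angle N]/S cos_spiral_end sin_spiral_end !mul1r.
    have gaE : ga (h v) = r * gauge kappa (cos a) (sin a).
      by rewrite /ga radh alh gaugeZ // (le_trans ler01).
    have gbE : gb (h v) = rho * gauge kappa (cos a) (sin a).
      by rewrite /gb uhv xE yE gaugeZ // ltW.
    have r0 : 0 < r by rewrite (lt_le_trans ltr01).
    have nu0 : gauge kappa (cos a) (sin a) != 0.
      by apply/eqP => nu; move: A1; rewrite gaE nu mulr0 ltr10.
    have sE : scaling (ga (h v)) (gb (h v)) (ga (h v)) = rho / r.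
      have := scalingE (gb (h v)) A1 A1; rewrite lexx [ga _ + _]addrC addrK.
      move=> H; apply: (mulfI (lt0r_neq0 (lt_trans ltr01 A1))).
      by rewrite H gbE gaE; field; rewrite gt_eqF.
    by rewrite sE xE yE; congr point3; field; rewrite gt_eqF.
  rewrite /f twisted stretched !point3E mul1r [h v + _]addrC subrK.
  have kh : k (h v) = - (c * v) by rewrite /k -hxE // hxK.
  rewrite kh /stick_arc.
  have -> : M%:R * (v / E) = c * v by rewrite /c; ring.
  by [].
rewrite (_ : stick_arc @` `[0, 1] = f 1 @` W) //.
rewrite WE; apply/seteqP; split=> [_ [s + <-]|_ [_ [v + <-] <-]];
    rewrite /= in_itv /= => /andP[s0 s1].
  exists (point3 (winding_x n (s * E)) (winding_y n (s * E)) (h (s * E))).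
    exists (s * E) => //; rewrite /= in_itv /= mulr_ge0 ?(ltW E0) //=.
    by rewrite ler_piMl // ltW.
  rewrite image ?mulfK ?gt_eqF // mulr_ge0 ?(ltW E0) //=.
  by rewrite ler_piMl // ltW.
exists (v / E); last by rewrite image // s0.
by rewrite /= in_itv /= divr_ge0 ?(ltW E0) //= ler_pdivrMr // mul1r.
Qed.

End UpperBound.

Theorem corollary3p10 (R : realType) (n : int) (W : set 'rV[R]_3) :
  n != 0%R -> winding_rail_arc n W ->
  stick_number (tail_rail R) (head_rail R) W = (4 + 2 * (`|n| - 1))%N.
Proof.
move=> n0 Wn; have N0 : (0 < `|n|)%N by rewrite absz_gt0.
have -> : (4 + 2 * (`|n| - 1) = 2 * `|n| + 2)%N.
  by rewrite mulnBr muln1 addnBA ?leq_pmulr // addnC -addnBA.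
rewrite /stick_number; case: xgetP => [k _ /= [kP kmin]|/(_ (2 * `|n| + 2)%N)].
  apply/eqP; rewrite eqn_leq (winding_sticks_ge n0 Wn kP) andbT.
  by apply: kmin; exact: winding_sticks_le.
case; split; first exact: winding_sticks_le.
by move=> m; exact: winding_sticks_ge.
Qed.
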